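(* Let $\mathcal{U}=\{u_0,\dots,u_{18}\}$ be the set of 19 Wang tiles listed in the context and let $\Omega_{\mathcal{U}}\subseteq\mathcal{U}^{\mathbb{Z}^2}$ be its Wang shift. Then $\Omega_{\mathcal{U}}$ is self-similar, aperiodic and minimal.
   Context: A Wang tile is a 4-tuple $\tau=(a,b,c,d)$ of colors, $a=\mathrm{right}(\tau)$, $b=\mathrm{top}(\tau)$, $c=\mathrm{left}(\tau)$, $d=\mathrm{bottom}(\tau)$. For a finite set $\mathcal{T}$ of Wang tiles, the Wang shift $\Omega_{\mathcal{T}}$ is the set of all $x:\mathbb{Z}^2\to\mathcal{T}$ with $\mathrm{right}(x(\mathbf n))=\mathrm{left}(x(\mathbf n+\mathbf e_1))$ and $\mathrm{top}(x(\mathbf n))=\mathrm{bottom}(x(\mathbf n+\mathbf e_2))$ for all $\mathbf n\in\mathbb{Z}^2$, where $\mathbf e_1=(1,0)$, $\mathbf e_2=(0,1)$. The tile set $\mathcal{U}$, written as (right, top, left, bottom): $u_0=(F,O,J,O)$, $u_1=(F,O,H,L)$, $u_2=(J,M,F,P)$, $u_3=(D,M,F,K)$, $u_4=(H,P,J,P)$, $u_5=(H,P,H,N)$, $u_6=(H,K,F,P)$, $u_7=(H,K,D,P)$, $u_8=(B,O,I,O)$, $u_9=(G,L,E,O)$, $u_{10}=(G,L,C,L)$, $u_{11}=(A,L,I,O)$, $u_{12}=(E,P,G,P)$, $u_{13}=(E,P,I,P)$, $u_{14}=(I,P,G,K)$, $u_{15}=(I,P,I,K)$, $u_{16}=(I,K,B,M)$,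 $u_{17}=(I,K,A,K)$, $u_{18}=(C,N,I,P)$. The shift action on $\mathcal{A}^{\mathbb{Z}^2}$ ($\mathcal{A}$ finite, product topology) is $(\sigma^{\mathbf n}x)_{\mathbf m}=x_{\mathbf m+\mathbf n}$. A subshift is a closed shift-invariant subset of $\mathcal{A}^{\mathbb{Z}^2}$; it is minimal if it contains no nonempty, proper, closed shift-invariant subset. A nonempty Wang shift is aperiodic if no $x$ in it satisfies $\sigma^{\mathbf p}x=x$ for some $\mathbf p\in\mathbb{Z}^2\setminus\{(0,0)\}$. A 2-dimensional word of shape $(n_1,n_2)\in\mathbb{N}^2$ over $\mathcal{A}$ is a map $\{0,\dots,n_1-1\}\times\{0,\dots,n_2-1\}\to\mathcal{A}$; $\mathcal{A}^{*^2}$ is the set of all of them. Two words can be concatenated in direction $\mathbf e_i$ if their shapes agree except possibly in coordinate $i$. A 2-dimensional morphism is given by images $\omega(a)\in\mathcal{A}^{*^2}$ of letters $a\in\mathcal{A}$ and satisfies $\omega(u\odot^i v)=\omega(u)\odot^i\omega(v)$ (both sides well-defined) for words $u,v$ such that $u\odot^i v$ is a well-defined word in its domain, where $\odot^i$ is concatenation in direction $\mathbf e_i$. It applies to a configuration $x$ when the images of any two letters of $x$ at positions $\mathbf n,\mathbf n+\mathbf e_i$ can be concatenated in direction $\mathbf e_i$; then $\omega(x)\in\mathcal{A}^{\mathbb{Z}^2}$ is obtained by concatenating all the images, with the lower-left corner of $\omega(x_{\mathbf 0})$ at the origin. It is expansive if for every $a\in\mathcal{A}$ and $K\in\mathbb{N}$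 there is $m$ with $\min(\mathrm{shape}(\omega^m(a)))>K$. A subshift $X\subseteq\mathcal{A}^{\mathbb{Z}^2}$ is self-similar if there is an expansive 2-dimensional morphism $\omega:\mathcal{A}\to\mathcal{A}^{*^2}$ (applicable to all elements of $X$) such that $X=\overline{\omega(X)}^{\sigma}$, where $\overline{\omega(X)}^{\sigma}=\{\sigma^{\mathbf k}\omega(x):\mathbf k\in\mathbb{Z}^2,\ x\in X\}$. *)

(* Defs.v *)
From HB Require Import structures.
From mathcomp Require Import all_boot all_order all_algebra.
From mathcomp Require Import boolp classical_sets topology.

Set Implicit Arguments.
Unset Strict Implicit.
Unset Printing Implicit Defensive.

Import GRing.Theory.
Local Open Scope classical_set_scope.
Local Open Scope ring_scope.

(** * Configurations and subshifts *)

Definition e1 : int * int := (1, 0).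
Definition e2 : int * int := (0, 1).

(* [discrete_topology A] is [A] itself; [{ptws _ -> _}] carries the product
   topology. *)
Definition config (A : finType) : Type :=
  {ptws (int * int) -> discrete_topology A}.
HB.instance Definition _ (A : finType) := Topological.on (config A).

Definition shift (A : finType) (n : int * int) (x : config A) : config A :=
  fun m => x (m + n).

Definition shift_invariant (A : finType) (X : set (config A)) : Prop :=
  forall (n : int * int) (x : config A), X x -> X (shift n x).

Definition subshift (A : finType) (X : set (config A)) : Prop :=
  closed X /\ shift_invariant X.

Definition minimal (A : finType) (X : set (config A)) : Prop :=
  subshift X /\
  ~ exists Y : set (config A),
      [/\ Y !=set0, Y `<` X, closed Y & shift_invariant Y].

Definition aperiodic (A : finType) (X : set (config A)) : Prop :=
  X !=set0 /\
  ~ exists x : config A, X x /\ exists2 p : int * int, p != 0 & shift p x = x.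

(** * Two-dimensional words *)

(* The first coordinate of a cell runs along [e1] (left to right) and the second
   along [e2] (bottom to top); the shape is [(width, height)]. *)
Record word (A : finType) : Type := Word {
  width : nat;
  height : nat;
  cell : {ffun 'I_width * 'I_height -> A}
}.

Definition cell_at (A : finType) (w : word A) (i j : nat) : option A :=
  if (insub i : option 'I_(width w), insub j : option 'I_(height w))
    is (Some i', Some j') then Some (cell w (i', j')) else None.

Definition letter (A : finType) (a : A) : word A :=
  @Word A 1 1 [ffun=> a].

Definition nonempty_word (A : finType) (w : word A) : bool :=
  (0 < width w)%N && (0 < height w)%N.

Definition concatenable1 (A : finType) (u v : word A) : bool :=
  height u == height v.

Definition concatenable2 (A : finType) (u v : word A) : bool :=
  width u == width v.

(* [is_cat1 u v w]: the concatenation of [u] and [v] in direction [e1] is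
   well-defined and is equal to [w]. *)
Definition is_cat1 (A : finType) (u v w : word A) : Prop :=
  [/\ concatenable1 u v,
      width w = (width u + width v)%N,
      height w = height u &
      forall i j, cell_at w i j =
        if (i < width u)%N then cell_at u i j
        else cell_at v (i - width u)%N j].

Definition is_cat2 (A : finType) (u v w : word A) : Prop :=
  [/\ concatenable2 u v,
      width w = width u,
      height w = (height u + height v)%N &
      forall i j, cell_at w i j =
        if (j < height u)%N then cell_at u i j
        else cell_at v i (j - height u)%N].

(** * Two-dimensional morphisms *)

(* A two-dimensional morphism is a partial map on words ([None] off its domain),
   since the images of two adjacent letters need not be concatenable.  It is
   given by its images [mor1] of letters, and its domain consists of nonempty
   words: a word of shape [(0, 1)] is neutral for concatenation with letters in
   direction [e1], so that if it could be used in [mor_cat1], the images of all the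
   letters would have the same height. *)
Record morphism2 (A : finType) : Type := Morphism2 {
  mor1 :> A -> word A;
  mor : word A -> option (word A);
  mor_letter : forall a, mor (letter a) = Some (mor1 a);
  mor_dom : forall w w', mor w = Some w' -> nonempty_word w;
  mor_cat1 : forall u v w w', nonempty_word u -> nonempty_word v -> is_cat1 u v w ->
    mor w = Some w' ->
    exists u' v', [/\ mor u = Some u', mor v = Some v' & is_cat1 u' v' w'];
  mor_cat2 : forall u v w w', nonempty_word u -> nonempty_word v -> is_cat2 u v w ->
    mor w = Some w' ->
    exists u' v', [/\ mor u = Some u', mor v = Some v' & is_cat2 u' v' w']
}.

Definition mor_iter (A : finType) (omega : morphism2 A) (m : nat) (w : word A) :
  option (word A) := iter m (obind (mor omega)) (Some w).

Definition expansive (A : finType) (omega : morphism2 A) : Prop :=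
  forall (a : A) (K : nat), exists m w,
    mor_iter omega m (letter a) = Some w /\ (K < minn (width w) (height w))%N.

Definition applies_to (A : finType) (omega : morphism2 A) (x : config A) : Prop :=
  forall n : int * int,
    concatenable1 (omega (x n)) (omega (x (n + e1))) /\
    concatenable2 (omega (x n)) (omega (x (n + e2))).

(* The coordinate at which the [k]-th of consecutive blocks of lengths
   [..., l (-1), l 0, l 1, ...] starts, the block of index [0] starting at [0]. *)
Definition offset (l : int -> nat) (k : int) : int :=
  match k with
  | Posz n => \sum_(i < n) (l (Posz i))%:Z
  | Negz n => - \sum_(i < n.+1) (l (Negz i))%:Z
  end.

(* [is_image omega x y]: [omega] applies to [x] and the image of [x] is [y].  All
   the blocks of a column of [x] have the same width and all those of a row the
   same height, so these can be read off row [0] and column [0].  When [omega]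
   has no empty image, as is the case when it is expansive, the blocks tile the
   plane and [y] is determined by [x]. *)
Definition is_image (A : finType) (omega : morphism2 A) (x y : config A) : Prop :=
  applies_to omega x /\
  forall (n : int * int) (i j : nat) (a : A),
    cell_at (omega (x n)) i j = Some a ->
    y (offset (fun k => width (omega (x (k, 0)))) n.1 + i%:Z,
       offset (fun k => height (omega (x (0, k)))) n.2 + j%:Z) = a.

Definition self_similar (A : finType) (X : set (config A)) : Prop :=
  subshift X /\
  exists omega : morphism2 A,
    [/\ expansive omega,
        forall x, X x -> applies_to omega x &
        X = [set y | exists (k : int * int) (x z : config A),
                       [/\ X x, is_image omega x z & y = shift k z]]].

(** * Wang tiles *)

Definition wang_tile (C : Type) : Type := (C * C * C * C)%type.

Definition right (C : Type) (t : wang_tile C) : C := let: (a, _, _, _) := t in a.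
Definition top (C : Type) (t : wang_tile C) : C := let: (_, b, _, _) := t in b.
Definition left (C : Type) (t : wang_tile C) : C := let: (_, _, c, _) := t in c.
Definition bottom (C : Type) (t : wang_tile C) : C := let: (_, _, _, d) := t in d.

HB.instance Definition _ (C : choiceType) :=
  Choice.copy (wang_tile C) (C * C * C * C)%type.

(* The alphabet [seq_sub T] is the finite type of the elements of [T]. *)
Definition wang_shift (C : choiceType) (T : seq (wang_tile C)) :
  set (config (seq_sub T)) :=
  [set x | forall n : int * int,
     right (ssval (x n)) = left (ssval (x (n + e1))) /\
     top (ssval (x n)) = bottom (ssval (x (n + e2)))].
Arguments wang_shift {C} T.

(** * The tile set U *)

Inductive color : Type :=
  cA | cB | cC | cD | cE | cF | cG | cH | cI | cJ | cK | cL | cM | cN | cO | cP.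

Definition colors : seq color :=
  [:: cA; cB; cC; cD; cE; cF; cG; cH; cI; cJ; cK; cL; cM; cN; cO; cP].

Definition color_code (c : color) : nat :=
  match c with
  | cA => 0 | cB => 1 | cC => 2 | cD => 3 | cE => 4 | cF => 5 | cG => 6 | cH => 7
  | cI => 8 | cJ => 9 | cK => 10 | cL => 11 | cM => 12 | cN => 13 | cO => 14
  | cP => 15
  end%N.

Lemma color_codeK : pcancel color_code (fun n => nth None (map some colors) n).
Proof. by case. Qed.

HB.instance Definition _ := Countable.copy color (pcan_type color_codeK).

Definition U : seq (wang_tile color) := [::
  (cF, cO, cJ, cO);
  (cF, cO, cH, cL);
  (cJ, cM, cF, cP);
  (cD, cM, cF, cK);
  (cH, cP, cJ, cP);
  (cH, cP, cH, cN);
  (cH, cK, cF, cP);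
  (cH, cK, cD, cP);
  (cB, cO, cI, cO);
  (cG, cL, cE, cO);
  (cG, cL, cC, cL);
  (cA, cL, cI, cO);
  (cE, cP, cG, cP);
  (cE, cP, cI, cP);
  (cI, cP, cG, cK);
  (cI, cP, cI, cK);
  (cI, cK, cB, cM);
  (cI, cK, cA, cK);
  (cC, cN, cI, cP)].

(* Main.v *)
Require Import Defs.
From mathcomp Require Import all_boot all_order all_algebra.
From mathcomp Require Import zify.
From mathcomp Require Import boolp classical_sets cardinality topology.

Set Implicit Arguments.
Unset Strict Implicit.
Unset Printing Implicit Defensive.

Import Order.TTheory GRing.Theory Num.Theory.
Local Open Scope classical_set_scope.
Local Open Scope ring_scope.

(** The 19 tiles admit a substitution [omega] sending each tile to a block of
    width and height 1 or 2, and every statement below comes from the fact that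
    [omega] can be undone in a unique way.

    Desubstitution.  Whether a tile is [narrow] can be read off its vertical
    colours and whether it is [short] off its horizontal colours, so in a
    tiling the narrow tiles fill whole columns and the short tiles whole rows.
    An exhaustive list of the 5 by 4 legal patches shows that no two narrow
    columns and no two short rows are adjacent, and that gluing every narrow
    column to the column on its left and every short row to the row below cuts
    the plane into blocks that are all images of tiles ([window_facts]).  Two
    tiles match if and only if their images do ([hmatch_img], [vmatch_img]), so
    that the tiles read off these blocks again form a legal tiling
    ([desubstitution]) and conversely the image of a legal tiling is legal
    ([image_legal]).  With the growth of the iterates this is self-similarity.

    Aperiodicity.  The cuts and the blocks are determined by the tiling
    ([recognizability]); hence a period of a tiling descends to a period of its
    preimage, and it becomes strictly shorter because wide columns and tall rows
    exist ([period_shrinks]).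

    Minimality.  Only 50 squares of side 2 occur in tilings, and the image of any
    of them under [omega ^ 12] contains all of them, which is checked by passing
    through one square called [hub].  So each of them occurs in each tiling
    ([quads_occur]).  Any finite patch of a tiling lies in the [n]-th image of such
    a square when [n] is large, hence occurs in each tiling too ([window_occurs]),
    and every orbit is dense.

    Existence of a tiling follows from the legality of [omega ^ n] of a tile, of
    size at least [n], by compactness.

    Images under [omega] are handled through the relation [inflates], which
    records the positions where the blocks start; the partial map on words
    required of a morphism is the one defined by the relation [word_image]. *)

(** Fixes the types of the two components, so that the positions occurring in
    different statements are syntactically equal. *)
Local Notation pt := (@pair int int).

(** * The space of configurations *)

Section ConfigurationSpace.
Variable A : finType.
Implicit Types (x y : config A) (n : int * int).

Lemma nbhs_coord x n : nbhs x [set y : config A | y n = x n].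
Proof.
have := @proj_continuous _ (fun _ : int * int => discrete_topology A) n x.
by move=> /(_ [set x n]); apply; exact: discrete_set1.
Qed.

Definition box (r : nat) (n : int * int) : bool :=
  (`|n.1| <= r)%N && (`|n.2| <= r)%N.

(** A configuration that a closed set approximates on larger and larger boxes is
    the limit of a sequence of that set, as convergence is pointwise. *)
Lemma closed_approx (Y : set (config A)) x : closed Y ->
  (forall r, exists y, Y y /\ forall n, box r n -> y n = x n) -> Y x.
Proof.
move=> cY /choice [u Hu].
have cv : u @ \oo --> x.
  apply/cvg_sup => n V /=.
  case=> [_ [[B _ <-] Bx sB]].
  exists (`|n.1| + `|n.2|)%N => // r /= nr; apply: sB; rewrite /=.
  rewrite (Hu r).2 //; rewrite /box; lia.
apply: (closed_cvg _ cY _ _ cv).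
by exists 0%N => // r _; exact: (Hu r).1.
Qed.

Lemma config_compact : compact [set: config A].
Proof.
have -> : [set: config A] =
    [set f | forall n, [set: discrete_topology A] (f n)] by apply/seteqP.
apply: (@tychonoff _ (fun _ : int * int => discrete_topology A) (fun=> setT)) => _.
by apply: finite_compact; exact: finite_finset.
Qed.

(** Configurations [u r] satisfying [P r] have a cluster point, which belongs to
    each of the closed sets [P r] since the [P r] decrease. *)
Lemma compact_approx (P : nat -> set (config A)) :
  (forall r, closed (P r)) -> (forall r, P r !=set0) ->
  (forall r s, (r <= s)%N -> P s `<=` P r) -> exists x, forall r, P r x.
Proof.
move=> cP /choice [u Hu] mP.
have [|x [_ clx]] := config_compact (F := u @ \oo) _; first exact: filterT.
exists x => r; apply: cP => B xB; apply: clx => //.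
by exists r => // s /= rs; apply: mP (Hu s).
Qed.
End ConfigurationSpace.

(** * Words and induced morphisms *)

Section Words.
Variable A : finType.
Implicit Types (u v w : word A) (a : A).

Lemma cell_at_ord w (i : 'I_(width w)) (j : 'I_(height w)) :
  cell_at w i j = Some (cell w (i, j)).
Proof. by rewrite /cell_at !valK. Qed.

Lemma cell_at_bounds w i j a :
  cell_at w i j = Some a -> (i < width w)%N /\ (j < height w)%N.
Proof. by rewrite /cell_at; case: insubP => // i' ? _; case: insubP. Qed.

Lemma cell_at_Some w i j : (i < width w)%N -> (j < height w)%N ->
  exists a, cell_at w i j = Some a.
Proof.
by move=> iw jh; exists (cell w (Ordinal iw, Ordinal jh)); rewrite -cell_at_ord.
Qed.

Lemma cell_at_None w i j : (width w <= i)%N || (height w <= j)%N ->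
  cell_at w i j = None.
Proof.
case E: cell_at => [a|//]; have [iw jh] := cell_at_bounds E.
by rewrite leqNgt iw leqNgt jh.
Qed.

Lemma word_ext u v : width u = width v -> height u = height v ->
  (forall i j, (i < width u)%N -> (j < height u)%N ->
     cell_at u i j = cell_at v i j) -> u = v.
Proof.
case: u v => [m n f] [m' n' g] /= em en; case: _ / em g => g; case: _ / en g => g H.
congr Word; apply/ffunP => -[i j].
apply: Some_inj.
by rewrite -[LHS](@cell_at_ord (Word f)) -[RHS](@cell_at_ord (Word g)) H.
Qed.

(** Words are built from partial functions because [cell_at] is one; the
    hypothesis says that no default letter is ever read. *)
Lemma word_build m n (f : nat -> nat -> option A) :
  (forall i j, (i < m)%N -> (j < n)%N -> f i j <> None) ->
  exists w, [/\ width w = m, height w = n &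
    forall i j, (i < m)%N -> (j < n)%N -> cell_at w i j = f i j].
Proof.
move=> H; have H' (ij : 'I_m * 'I_n) : exists a, f ij.1 ij.2 = Some a.
  by case E: f => [a|]; [exists a | case: (H ij.1 ij.2 _ _ E)].
exists (Word [ffun ij => projT1 (cid (H' ij))]); split=> // i j im jn.
rewrite (@cell_at_ord (Word _) (Ordinal im) (Ordinal jn)) /= ffunE.
by case: cid.
Qed.

(** Exchanges the two directions, so that facts on concatenation in the second
    direction follow from those on the first. *)
Definition transpose w : word A := Word [ffun ij => cell w (ij.2, ij.1)].

Lemma cell_at_transpose w i j : cell_at (transpose w) i j = cell_at w j i.
Proof.
rewrite /cell_at /=; case: insubP => [i' _ _|_]; case: insubP => //= j' _ _.
by rewrite ffunE.
Qed.

Lemma transposeK : involutive transpose.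
Proof. by move=> w; apply: word_ext => // i j _ _; rewrite !cell_at_transpose. Qed.

Lemma is_cat2_transpose u v w :
  is_cat2 u v w -> is_cat1 (transpose u) (transpose v) (transpose w).
Proof.
case=> ? ? ? H; split=> // i j; rewrite !cell_at_transpose H.
by case: ifP.
Qed.

Lemma is_cat1_transpose u v w :
  is_cat1 u v w -> is_cat2 (transpose u) (transpose v) (transpose w).
Proof.
case=> ? ? ? H; split=> // i j; rewrite !cell_at_transpose H.
by case: ifP.
Qed.

(** The image of [w] under the letter images [phi]: [p i] and [q j] are the
    abscissa and the ordinate at which the image of the letter of [w] at [(i, j)]
    starts.  The single functions [p] and [q] force the images of the letters of a
    column to have the same width and those of a row the same height. *)
Definition word_image (phi : A -> word A) w w' : Prop :=
  nonempty_word w /\ exists p q : nat -> nat,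
    [/\ p 0%N = 0%N, q 0%N = 0%N, width w' = p (width w),
        height w' = q (height w) &
        forall i j a, cell_at w i j = Some a ->
        [/\ p i.+1 = (p i + width (phi a))%N, q j.+1 = (q j + height (phi a))%N &
            forall i' j' b, cell_at (phi a) i' j' = Some b ->
              cell_at w' (p i + i') (q j + j') = Some b]].

Lemma word_image_transpose phi w w' :
  word_image phi w w' ->
  word_image (transpose \o phi) (transpose w) (transpose w').
Proof.
case=> ne [p [q [p0 q0 ew eh H]]]; split; first by rewrite /nonempty_word andbC.
exists q, p; split=> // i j a; rewrite cell_at_transpose => /H[Hp Hq Hc].
by split=> // i' j' b; rewrite !cell_at_transpose => /Hc.
Qed.

Lemma locate_nat (p : nat -> nat) n I : p 0%N = 0%N -> (I < p n)%N ->
  exists i, (i < n)%N && (p i <= I < p i.+1)%N.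
Proof.
move=> p0; elim: n => [|n IHn] In; first by move: In; rewrite p0.
case: (ltnP I (p n)) => [/IHn[i /andP[? ?]]|nI]; last by exists n; lia.
by exists i; apply/andP; split => //; lia.
Qed.

Section Image.
Variable phi : A -> word A.

(** The cuts are computed from the left and bottom edges of [w], and every cell of
    the image falls in one block. *)
Lemma word_image_uniq w w1 w2 :
  word_image phi w w1 -> word_image phi w w2 -> w1 = w2.
Proof.
case=> /andP[w0 h0] [p1 [q1 [p10 q10 W1 H1 C1]]].
case=> _ [p2 [q2 [p20 q20 W2 H2 C2]]].
have ep i : (i <= width w)%N -> p1 i = p2 i.
  elim: i => [|i IH] iw; first by rewrite p10 p20.
  have [a Ea] := cell_at_Some iw h0.
  have [-> _ _] := C1 _ _ _ Ea; have [-> _ _] := C2 _ _ _ Ea.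
  by rewrite IH // ltnW.
have eq i : (i <= height w)%N -> q1 i = q2 i.
  elim: i => [|i IH] iw; first by rewrite q10 q20.
  have [a Ea] := cell_at_Some w0 iw.
  have [_ -> _] := C1 _ _ _ Ea; have [_ -> _] := C2 _ _ _ Ea.
  by rewrite IH // ltnW.
apply: word_ext => [||I J]; first by rewrite W1 W2 ep.
  by rewrite H1 H2 eq.
rewrite W1 H1 => /(locate_nat p10)[i /andP[iw /andP[Ii Ii']]].
move=> /(locate_nat q10)[j /andP[jh /andP[Jj Jj']]].
have [a Ea] := cell_at_Some iw jh.
have [P1 Q1 D1] := C1 _ _ _ Ea; have [_ _ D2] := C2 _ _ _ Ea.
have [||b Eb] := @cell_at_Some (phi a) (I - p1 i) (J - q1 j); try lia.
have := D1 _ _ _ Eb; have := D2 _ _ _ Eb.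
rewrite -ep 1?ltnW // -eq 1?ltnW // !subnKC //.
by move=> -> ->.
Qed.

Lemma word_image_letter a : word_image phi (letter a) (phi a).
Proof.
split=> //; exists (fun i => i * width (phi a))%N, (fun j => j * height (phi a))%N.
split=> //=; rewrite ?mul1n // => i j b Eb.
have [/= i0 j0] := cell_at_bounds Eb.
have ei : i = 0%N by lia.
have ej : j = 0%N by lia.
subst i j; have -> : b = a.
  by move: Eb; rewrite (@cell_at_ord (letter a) ord0 ord0) ffunE => -[].
by split=> //; lia.
Qed.

(** The image of [w] is cut at the abscissa where the images of the letters of
    [v] begin. *)
Lemma word_image_cat1 u v w w' : nonempty_word u -> nonempty_word v ->
  is_cat1 u v w -> word_image phi w w' ->
  exists u' v', [/\ word_image phi u u', word_image phi v v' & is_cat1 u' v' w'].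
Proof.
move=> u0 v0 [/eqP uv ww hw Cw] [/andP[w0 h0] [p [q [p0 q0 W H C]]]].
have mono n i : (i + n <= width w)%N -> (p i <= p (i + n)%N)%N.
  elim: n => [|n IH] ?; first by rewrite addn0.
  have [|a Ea] := @cell_at_Some w (i + n) 0 _ h0; first by lia.
  by have [] := C _ _ _ Ea; rewrite addnS; lia.
have qmono n i : (i + n <= height w)%N -> (q i <= q (i + n)%N)%N.
  elim: n => [|n IH] ?; first by rewrite addn0.
  have [|a Ea] := @cell_at_Some w 0 (i + n) w0; first by lia.
  by have [] := C _ _ _ Ea; rewrite addnS; lia.
have pw : (p (width u) <= p (width w))%N by rewrite ww mono // ww.
have [|u' [U1 U2 U3]] := @word_build (p (width u)) (height w') (cell_at w').
  move=> i j ? ?; have [||a ->//] := @cell_at_Some w' i j; lia.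
have [|v' [V1 V2 V3]] := @word_build (p (width w) - p (width u)) (height w')
    (fun i j => cell_at w' (p (width u) + i) j).
  move=> i j ? ?; have [||a ->//] := @cell_at_Some w' (p (width u) + i) j; lia.
exists u', v'; split.
- split=> //; exists p, q; split=> //; first by rewrite U2 H hw.
  move=> i j a Ea; have [iu ju] := cell_at_bounds Ea.
  have [|P Q D] := C i j a; first by rewrite Cw iu.
  split=> // i' j' b Eb; have [iu' ju'] := cell_at_bounds Eb.
  rewrite U3; first exact: D.
    have := @mono (width u - i.+1)%N i.+1; rewrite subnKC // P; lia.
  have := @qmono (height w - j.+1)%N j.+1; rewrite subnKC ?Q -?H; lia.
- split=> //; exists (fun i => p (width u + i) - p (width u))%N, q; split=> //.
  + by rewrite addn0 subnn.
  + by rewrite V1 ww.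
  + by rewrite V2 H hw uv.
  move=> i j a Ea; have [iu ju] := cell_at_bounds Ea.
  have [|P Q D] := C (width u + i)%N j a.
    by rewrite Cw ltnNge leq_addr /= addKn.
  have M1 : (p (width u) <= p (width u + i)%N)%N by apply: mono; lia.
  split=> // [|i' j' b Eb]; first by rewrite addnS P; lia.
  have [iu' ju'] := cell_at_bounds Eb.
  have M2 := @mono (width w - (width u + i).+1)%N (width u + i).+1.
  rewrite subnKC ?P in M2; last by lia.
  rewrite V3; first by rewrite addnA subnKC //; exact: D.
    lia.
  have := @qmono (height w - j.+1)%N j.+1; rewrite subnKC ?Q -?H; lia.
- split; first by rewrite /concatenable1 U2 V2.
  + by rewrite U1 V1 subnKC // W.
  + by rewrite U2.
  move=> i j; rewrite U1; case: ifP => iu.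
    case: (ltnP j (height w')) => jh; first by rewrite U3.
    by rewrite !cell_at_None ?U2 ?jh ?orbT.
  case: (ltnP i (width w')) => iw; last first.
    by rewrite !cell_at_None ?V1 ?iw //; apply/orP; left; lia.
  case: (ltnP j (height w')) => jh; last by rewrite !cell_at_None ?V2 ?jh ?orbT.
  rewrite V3 //; last by lia.
  by congr cell_at; lia.
Qed.
End Image.

Lemma word_image_cat2 phi u v w w' : nonempty_word u -> nonempty_word v ->
  is_cat2 u v w -> word_image phi w w' ->
  exists u' v', [/\ word_image phi u u', word_image phi v v' & is_cat2 u' v' w'].
Proof.
move=> u0 v0 /is_cat2_transpose c /word_image_transpose im.
have tr_ne t : nonempty_word t -> nonempty_word (transpose t).
  by rewrite /nonempty_word andbC.
have [||u' [v' [iu iv /is_cat1_transpose c']]] := word_image_cat1 _ _ c im.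
- exact: tr_ne.
- exact: tr_ne.
have omK : transpose \o (transpose \o phi) = phi.
  by apply: funext => a /=; rewrite transposeK.
exists (transpose u'), (transpose v'); split.
- by have := word_image_transpose iu; rewrite transposeK omK.
- by have := word_image_transpose iv; rewrite transposeK omK.
by move: c'; rewrite transposeK.
Qed.

Section Induced.
Variable phi : A -> word A.

(** Images of words are unique by [word_image_uniq]; the map is defined exactly on
    the words that have one. *)
Definition word_mor (w : word A) : option (word A) :=
  if pselect (exists w', word_image phi w w') is Specif.left ex
  then Some (projT1 (cid ex)) else None.

Lemma word_morP w w' : word_mor w = Some w' <-> word_image phi w w'.
Proof.
rewrite /word_mor; case: pselect => [ex|nex]; last first.
  by split=> // H; case: nex; exists w'.
case: cid => w1 /= H1; split=> [[<-//]|H]; congr Some.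
exact: word_image_uniq H1 H.
Qed.

Fact word_mor_letter a : word_mor (letter a) = Some (phi a).
Proof. exact/word_morP/word_image_letter. Qed.

Fact word_mor_dom w w' : word_mor w = Some w' -> nonempty_word w.
Proof. by move/word_morP => -[]. Qed.

Fact word_mor_cat1 u v w w' : nonempty_word u -> nonempty_word v ->
  is_cat1 u v w -> word_mor w = Some w' ->
  exists u' v', [/\ word_mor u = Some u', word_mor v = Some v' & is_cat1 u' v' w'].
Proof.
move=> u0 v0 c /word_morP im.
have [u' [v' [iu iv c']]] := word_image_cat1 u0 v0 c im.
by exists u', v'; split=> //; apply/word_morP.
Qed.

Fact word_mor_cat2 u v w w' : nonempty_word u -> nonempty_word v ->
  is_cat2 u v w -> word_mor w = Some w' ->
  exists u' v', [/\ word_mor u = Some u', word_mor v = Some v' & is_cat2 u' v' w'].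
Proof.
move=> u0 v0 c /word_morP im.
have [u' [v' [iu iv c']]] := word_image_cat2 u0 v0 c im.
by exists u', v'; split=> //; apply/word_morP.
Qed.

Definition induced_mor : morphism2 A :=
  Morphism2 word_mor_letter word_mor_dom word_mor_cat1 word_mor_cat2.
End Induced.
End Words.

(** * Cut positions *)

Lemma int_step_ind (P : int -> Prop) :
  P 0 -> (forall k, P k <-> P (k + 1)) -> forall k, P k.
Proof.
move=> P0 PS; elim/int_ind => [//|n IH|n IH].
  by rewrite intS addrC; apply: (PS _).1.
by apply: (PS _).2; have -> : - n.+1%:Z + 1 = - n%:Z :> int by lia.
Qed.

Lemma offset0 (l : int -> nat) : offset l 0 = 0.
Proof. exact: big_ord0. Qed.

Lemma offsetS (l : int -> nat) k : offset l (k + 1) = offset l k + (l k)%:Z.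
Proof.
case: k => [n|[|n]].
- by rewrite addrC -intS /offset big_ord_recr.
- by rewrite [LHS]offset0 /offset big_ord_recl big_ord0 addr0 addNr.
have -> : Negz n.+1 + 1 = Negz n by lia.
by rewrite /offset [in RHS]big_ord_recr /= opprD addrNK.
Qed.

(** [offset] is the only sequence of cuts with the given block lengths, up to its
    value at 0. *)
Lemma cuts_offset (p : int -> int) (l : int -> nat) :
  (forall k, p (k + 1) = p k + (l k)%:Z) -> forall k, p k = p 0 + offset l k.
Proof.
move=> pS; apply: int_step_ind => [|k]; first by rewrite offset0 addr0.
by rewrite offsetS pS; split; lia.
Qed.

Lemma cuts_growth (p : int -> int) : (forall k, p k < p (k + 1)) ->
  forall k (n : nat), p k + n%:Z <= p (k + n%:Z).
Proof.
move=> pS k; elim=> [|n IH]; first by rewrite !addr0.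
have := pS (k + n%:Z); have -> : k + n%:Z + 1 = k + n.+1%:Z by lia.
lia.
Qed.

(** Consecutive blocks whose starts strictly increase leave no gap on the line. *)
Lemma cuts_cover (p : int -> int) : (forall k, p k < p (k + 1)) ->
  forall I, exists k, p k <= I < p (k + 1).
Proof.
move=> pS I; have pG := cuts_growth pS.
have locate (n : nat) k : p k <= I < p (k + n%:Z) ->
    exists k', p k' <= I < p (k' + 1).
  elim: n => [|n IH] /andP[kI]; first by rewrite addr0 => ?; lia.
  have -> : k + n.+1%:Z = (k + n%:Z) + 1 by lia.
  move=> In; case: (lerP (p (k + n%:Z)) I) => H; last by apply: IH; rewrite kI.
  by exists (k + n%:Z); rewrite H.
have [m mE] : exists m : nat, m = (`|(I - p 0)%R| + 1)%N by eexists.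
apply: (locate (m + m)%N (- m%:Z)).
have := pG (- m%:Z) m; have := pG 0 m; rewrite addNr add0r.
have -> : - m%:Z + (m + m)%N%:Z = m%:Z by lia.
move: (p 0) (p (- _)) (p m%:Z) mE => p0 P Q mE; lia.
Qed.

Lemma ptD k l k' l' : pt k l + pt k' l' = pt (k + k') (l + l').
Proof. by []. Qed.

Lemma pt_e1 k l : pt k l + e1 = pt (k + 1) l.
Proof. by rewrite ptD addr0. Qed.

Lemma pt_e2 k l : pt k l + e2 = pt k (l + 1).
Proof. by rewrite ptD addr0. Qed.

Section Inflation.
Variable A : finType.
Implicit Types x y : int * int -> A.

Definition crop x (k l : int) (a b : nat) : word A :=
  @Word A a b [ffun ij : 'I_a * 'I_b =>
    x (pt (k + (ij.1 : nat)%:Z) (l + (ij.2 : nat)%:Z))].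

Lemma cell_at_crop x k l a b i j : (i < a)%N -> (j < b)%N ->
  cell_at (crop x k l a b) i j = Some (x (pt (k + i%:Z) (l + j%:Z))).
Proof.
move=> ia jb.
by rewrite (@cell_at_ord _ (crop x k l a b) (Ordinal ia) (Ordinal jb)) /= ffunE.
Qed.

Lemma crop_ext x y k l k' l' a b :
  (forall i j : nat, (i < a)%N -> (j < b)%N ->
     x (pt (k + i%:Z) (l + j%:Z)) = y (pt (k' + i%:Z) (l' + j%:Z))) <->
  crop x k l a b = crop y k' l' a b.
Proof.
split=> [H|E i j ia jb].
  by apply: word_ext => // i j ia jb; rewrite !cell_at_crop // H.
by apply: Some_inj; rewrite -(@cell_at_crop x k l a b) // E cell_at_crop.
Qed.

Lemma crop1 x k l : crop x k l 1 1 = letter (x (pt k l)).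
Proof.
apply: word_ext => // i j ia jb; rewrite cell_at_crop //.
have -> : i = 0%N by move: ia => /=; lia.
have -> : j = 0%N by move: jb => /=; lia.
rewrite (@cell_at_ord _ (letter _) ord0 ord0) /= ffunE !addr0 //.
Qed.

Variable phi : A -> word A.

(** [y] contains, for each cell [(k, l)] of [D], the image of the letter [x (k, l)]
    with its lower left corner at [(p k, q l)].  Unlike [is_image], the origin of
    [y] is not constrained, so that shifts disappear, and [D] may be a finite patch,
    so that the same relation serves for words and for configurations. *)
Definition inflates (D : set (int * int)) x (p q : int -> int) y : Prop :=
  forall k l, D (pt k l) ->
  [/\ p (k + 1) = p k + (width (phi (x (pt k l))))%:Z,
      q (l + 1) = q l + (height (phi (x (pt k l))))%:Z &
      forall i j a, cell_at (phi (x (pt k l))) i j = Some a ->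
        y (pt (p k + i%:Z) (q l + j%:Z)) = a].

Definition rect (k l : int) (a b : nat) : set (int * int) :=
  [set n | (k <= n.1 < k + a%:Z) && (l <= n.2 < l + b%:Z)].

(** The cuts restricted to a rectangle are the ones required by [word_image]. *)
Lemma inflates_crop x p q y k l a b :
  inflates (rect k l a b) x p q y -> (0 < a)%N -> (0 < b)%N ->
  exists a' b', [/\ p (k + a%:Z) = p k + a'%:Z, q (l + b%:Z) = q l + b'%:Z &
    word_image phi (crop x k l a b) (crop y (p k) (q l) a' b')].
Proof.
move=> H a0 b0.
have inD (i j : nat) : (i < a)%N -> (j < b)%N ->
    rect k l a b (pt (k + i%:Z) (l + j%:Z)) by rewrite /rect /=; lia.
have stepp (i j : nat) : (i < a)%N -> (j < b)%N ->
    p (k + i.+1%:Z) = p (k + i%:Z) +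
      (width (phi (x (pt (k + i%:Z) (l + j%:Z)))))%:Z.
  move=> ia jb; have [<- _ _] := H _ _ (inD i j ia jb); congr p; lia.
have stepq (i j : nat) : (i < a)%N -> (j < b)%N ->
    q (l + j.+1%:Z) = q (l + j%:Z) +
      (height (phi (x (pt (k + i%:Z) (l + j%:Z)))))%:Z.
  move=> ia jb; have [_ <- _] := H _ _ (inD i j ia jb); congr q; lia.
have [P PE] : exists P : nat -> nat,
    forall i : nat, (i <= a)%N -> p (k + i%:Z) = p k + (P i)%:Z.
  exists (fun i => `|(p (k + i%:Z) - p k)%R|%N) => i ia.
  suff : 0 <= p (k + i%:Z) - p k by lia.
  elim: i ia => [|i IH] ia; first by rewrite addr0 subrr.
  by rewrite (stepp i 0%N) //; have := IH (ltnW ia); lia.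
have [Q QE] : exists Q : nat -> nat,
    forall j : nat, (j <= b)%N -> q (l + j%:Z) = q l + (Q j)%:Z.
  exists (fun j => `|(q (l + j%:Z) - q l)%R|%N) => j jb.
  suff : 0 <= q (l + j%:Z) - q l by lia.
  elim: j jb => [|j IH] jb; first by rewrite addr0 subrr.
  by rewrite (stepq 0%N j) //; have := IH (ltnW jb); lia.
have P0 : P 0%N = 0%N by have := PE 0%N isT; rewrite addr0; lia.
have Q0 : Q 0%N = 0%N by have := QE 0%N isT; rewrite addr0; lia.
exists (P a), (Q b); split; [exact: PE | exact: QE |].
split; first by rewrite /nonempty_word /= a0.
exists P, Q; split=> //.
move=> i j c Ec; have [/= ia jb] := cell_at_bounds Ec.
move: Ec; rewrite cell_at_crop // => -[<-] {c}.
have sp := stepp i j ia jb; have sq := stepq i j ia jb.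
rewrite !PE ?(ltnW ia) // in sp; rewrite !QE ?(ltnW jb) // in sq.
split; try lia.
move=> i' j' c Ec; have [/= iw jh] := cell_at_bounds Ec.
have eP n : (i.+1 + n <= a)%N -> (P i.+1 <= P (i.+1 + n)%N)%N.
  elim: n => [|n IH] na; first by rewrite addn0.
  have := stepp (i.+1 + n)%N 0%N; rewrite -addnS !PE //; [|lia..].
  by have := IH; lia.
have eQ n : (j.+1 + n <= b)%N -> (Q j.+1 <= Q (j.+1 + n)%N)%N.
  elim: n => [|n IH] nb; first by rewrite addn0.
  have := stepq 0%N (j.+1 + n)%N; rewrite -addnS !QE //; [|lia..].
  by have := IH; lia.
have := eP (a - i.+1)%N; have := eQ (b - j.+1)%N; rewrite !subnKC // => eQ' eP'.
rewrite cell_at_crop; try lia.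
have [_ _ E] := H _ _ (inD i j ia jb); rewrite -(E _ _ _ Ec) PE ?QE; try lia.
by congr (Some (y (pt _ _))); lia.
Qed.

Lemma inflates_sub (D D' : set (int * int)) x p q y :
  D' `<=` D -> inflates D x p q y -> inflates D' x p q y.
Proof. by move=> sD H k l /sD /H. Qed.

Hypothesis phi_nonempty : forall a, nonempty_word (phi a).

Lemma inflates_cuts x p q y : inflates setT x p q y ->
  (forall k, p k < p (k + 1)) /\ (forall l, q l < q (l + 1)).
Proof.
move=> H; split=> k.
  by have [-> _ _] := H k 0 I; have /andP[+ _] := phi_nonempty (x (pt k 0)); lia.
by have [_ -> _] := H 0 k I; have /andP[_ +] := phi_nonempty (x (pt 0 k)); lia.
Qed.

Lemma inflates_cover x p q y : inflates setT x p q y -> forall n,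
  exists k l i j, [/\ n = pt (p k + i%:Z) (q l + j%:Z), 
    (i < width (phi (x (pt k l))))%N & (j < height (phi (x (pt k l))))%N].
Proof.
move=> H [I J]; have [pS qS] := inflates_cuts H.
have [k /andP[k1 k2]] := cuts_cover pS I; have [l /andP[l1 l2]] := cuts_cover qS J.
have [pE qE _] := H k l Logic.I.
exists k, l, `|(I - p k)%R|%N, `|(J - q l)%R|%N; split; [congr pair| |]; lia.
Qed.

Lemma is_image_inflates (x z : config A) : is_image (induced_mor phi) x z ->
  inflates setT x (offset (fun k => width (phi (x (pt k 0)))))
                  (offset (fun l => height (phi (x (pt 0 l))))) z.
Proof.
case=> ap H k l _.
have ew l' : width (phi (x (pt k l'))) = width (phi (x (pt k 0))).
  move: l'; apply: int_step_ind => // l'.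
  by have [_ /eqP /=] := ap (pt k l'); rewrite pt_e2 => ->.
have eh k' : height (phi (x (pt k' l))) = height (phi (x (pt 0 l))).
  move: k'; apply: int_step_ind => // k'.
  by have [/eqP /= + _] := ap (pt k' l); rewrite pt_e1 => ->.
by split=> [||i j a Ha]; rewrite ?offsetS ?ew ?eh //; exact: H (pt k l) i j a Ha.
Qed.

Lemma inflates_is_image (x y : config A) p q : inflates setT x p q y ->
  is_image (induced_mor phi) x (shift (pt (p 0) (q 0)) y).
Proof.
move=> H; split=> [[k l]|[k l] i j a Ha].
  have [pE qE _] := H k l I; rewrite pt_e1 pt_e2.
  have [_ qE' _] := H (k + 1) l I; have [pE' _ _] := H k (l + 1) I.
  by split; apply/eqP; rewrite /=; lia.
have [_ _ E] := H k l I; rewrite -(E _ _ _ Ha) /shift ptD; congr (y (pt _ _)).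
  rewrite [p k](@cuts_offset p (fun k => width (phi (x (pt k 0))))).
    by rewrite [LHS]addrC addrA.
  by move=> k'; have [] := H k' 0 I.
rewrite [q l](@cuts_offset q (fun l => height (phi (x (pt 0 l))))).
  by rewrite [LHS]addrC addrA.
by move=> l'; have [] := H 0 l' I.
Qed.
End Inflation.

(** * The nineteen tiles and their images *)

Local Notation tile := (seq_sub U).

(** The default value belongs to [U], so that every index denotes a tile. *)
Definition u (i : nat) : wang_tile color := nth (cF, cO, cJ, cO) U i.

Definition hmatch (a b : nat) : bool := right (u a) == left (u b).
Definition vmatch (a b : nat) : bool := top (u a) == bottom (u b).

(** Locked, because comparing the indices of two unknown tiles by unfolding
    expands the search in [U] on both sides. *)
Definition num : tile -> nat := locked (fun t => index (ssval t) U).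

Lemma numE t : num t = index (ssval t) U. Proof. by rewrite /num -lock. Qed.

Definition nums : seq nat := iota 0 19.

Lemma u_in i : u i \in U.
Proof.
rewrite /u; case: (ltnP i (size U)) => [|ge]; first exact: mem_nth.
by rewrite nth_default.
Qed.

Definition tile_of (i : nat) : tile := SeqSub (u_in i).

Lemma num_in t : num t \in nums.
Proof. by rewrite mem_iota /= add0n numE -[19%N]/(size U) index_mem (valP t). Qed.

Lemma u_num t : u (num t) = ssval t.
Proof. by rewrite /u numE nth_index // (valP t). Qed.

Lemma num_inj : injective num.
Proof. by move=> s t e; apply: val_inj; rewrite /= -!u_num e. Qed.

Lemma num_tile_of i : i \in nums -> num (tile_of i) = i.
Proof. by rewrite mem_iota => ?; rewrite numE index_uniq. Qed.

(** The tiles with vertical colours O and L; they make up the right columns of the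
    images of [omega]. *)
Definition narrow (a : nat) : bool := a \in [:: 0; 1; 8; 9; 10; 11]%N.

(** The tiles with horizontal colours D, F, H and J; they make up the upper rows of
    the images of [omega]. *)
Definition short (a : nat) : bool := (a < 8)%N.

(** Narrow tiles have images of width 1 and all others of width 2: along a row,
    [omega] acts as the Fibonacci substitution, and likewise along a column. *)
Definition img_width (a : nat) : nat := if narrow a then 1 else 2.
Definition img_height (a : nat) : nat := if short a then 1 else 2.

(** The images of the tiles 0 to 18, each given by its rows from bottom to top. *)
Definition image_rows : seq (seq (seq nat)) := [::
  [:: [:: 17]]; [:: [:: 16]]; [:: [:: 15; 11]]; [:: [:: 13; 9]];
  [:: [:: 17; 8]]; [:: [:: 16; 8]]; [:: [:: 15; 8]]; [:: [:: 14; 8]];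
  [:: [:: 14]; [:: 6]]; [:: [:: 17]; [:: 3]];
  [:: [:: 16]; [:: 3]]; [:: [:: 14]; [:: 2]];
  [:: [:: 15; 11]; [:: 7; 1]]; [:: [:: 14; 11]; [:: 6; 1]];
  [:: [:: 13; 9]; [:: 7; 1]]; [:: [:: 12; 9]; [:: 6; 1]];
  [:: [:: 18; 10]; [:: 5; 1]]; [:: [:: 13; 9]; [:: 4; 1]];
  [:: [:: 14; 8]; [:: 2; 0]]]%N.

Definition img_cell (a i j : nat) : nat :=
  nth 0%N (nth [::] (nth [::] image_rows a) j) i.

Definition forall_cells (a : nat) (P : nat -> nat -> bool) : bool :=
  all (fun i => all (P i) (iota 0 (img_height a))) (iota 0 (img_width a)).

Lemma forall_cellsP a P i j : forall_cells a P ->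
  (i < img_width a)%N -> (j < img_height a)%N -> P i j.
Proof.
move=> /allP /(_ i); rewrite mem_iota add0n => H /H /allP /(_ j).
by rewrite mem_iota; apply.
Qed.

Lemma all2_nums (P : nat -> nat -> bool) : all (fun a => all (P a) nums) nums ->
  forall a b, a \in nums -> b \in nums -> P a b.
Proof. by move=> /allP H a b /H /allP; apply. Qed.

Lemma img_cellP a i j : a \in nums -> (i < img_width a)%N -> (j < img_height a)%N ->
  [/\ img_cell a i j \in nums, narrow (img_cell a i j) = (i == 1)%N
    & short (img_cell a i j) = (j == 1)%N].
Proof.
move=> an iw jh.
have /allP : all (fun a => forall_cells a (fun i j =>
  [&& img_cell a i j \in nums, narrow (img_cell a i j) == (i == 1)%N
    & short (img_cell a i j) == (j == 1)%N])) nums by vm_compute.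
by move=> /(_ a an) /forall_cellsP /(_ iw jh) /and3P[? /eqP ? /eqP ?].
Qed.

Lemma img_internal a i j : a \in nums ->
  (i < img_width a)%N -> (j < img_height a)%N ->
  ((i.+1 < img_width a)%N -> hmatch (img_cell a i j) (img_cell a i.+1 j)) /\
  ((j.+1 < img_height a)%N -> vmatch (img_cell a i j) (img_cell a i j.+1)).
Proof.
move=> an iw jh.
have /allP : all (fun a => forall_cells a (fun i j =>
  ((i.+1 < img_width a)%N ==> hmatch (img_cell a i j) (img_cell a i.+1 j)) &&
  ((j.+1 < img_height a)%N ==> vmatch (img_cell a i j) (img_cell a i j.+1)))) nums
  by vm_compute.
by move=> /(_ a an) /forall_cellsP /(_ iw jh) /andP[/implyP ? /implyP].
Qed.

(** The colour words on the vertical sides of the images are renamings of the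
    vertical side colours of the tiles, so that adjacency is both preserved and
    reflected by [omega]. *)
Lemma hmatch_img a b : a \in nums -> b \in nums ->
  hmatch a b = (img_height a == img_height b) &&
    all (fun j => hmatch (img_cell a (img_width a).-1 j) (img_cell b 0 j))
      (iota 0 (img_height a)).
Proof.
move=> an bn; pose P a b := hmatch a b == (img_height a == img_height b) &&
  all (fun j => hmatch (img_cell a (img_width a).-1 j) (img_cell b 0 j))
      (iota 0 (img_height a)).
have H : all (fun a => all (P a) nums) nums by vm_compute.
by have /(@eqP bool) := all2_nums H an bn.
Qed.

Lemma vmatch_img a b : a \in nums -> b \in nums ->
  vmatch a b = (img_width a == img_width b) &&
    all (fun i => vmatch (img_cell a i (img_height a).-1) (img_cell b i 0))
      (iota 0 (img_width a)).
Proof.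
move=> an bn; pose P a b := vmatch a b == (img_width a == img_width b) &&
  all (fun i => vmatch (img_cell a i (img_height a).-1) (img_cell b i 0))
      (iota 0 (img_width a)).
have H : all (fun a => all (P a) nums) nums by vm_compute.
by have /(@eqP bool) := all2_nums H an bn.
Qed.

Lemma hmatch_short a b : a \in nums -> b \in nums ->
  hmatch a b -> short a = short b.
Proof.
move=> an bn; rewrite hmatch_img // => /andP[+ _]; rewrite /img_height.
by do 2![case: short].
Qed.

Lemma vmatch_narrow a b : a \in nums -> b \in nums ->
  vmatch a b -> narrow a = narrow b.
Proof.
move=> an bn; rewrite vmatch_img // => /andP[+ _]; rewrite /img_width.
by do 2![case: narrow].
Qed.

Lemma img_inj a b : a \in nums -> b \in nums ->
  img_width a = img_width b -> img_height a = img_height b ->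
  (forall i j, (i < img_width a)%N -> (j < img_height a)%N ->
    img_cell a i j = img_cell b i j) -> a = b.
Proof.
move=> an bn ew eh H.
pose same a b := [&& img_width a == img_width b, img_height a == img_height b
  & forall_cells a (fun i j => img_cell a i j == img_cell b i j)].
have /implyP K : same a b ==> (a == b).
  pose P a b := same a b ==> (a == b).
  have C : all (fun a => all (P a) nums) nums by vm_compute.
  exact: (all2_nums C an bn).
apply/eqP/K; rewrite /same ew eh !eqxx; apply/allP => i.
rewrite mem_iota add0n => iw; apply/allP => j.
by rewrite mem_iota add0n => jh; apply/eqP/H.
Qed.

(** * Enumeration of legal patches *)

(** Tables of the possible neighbours, for the enumeration of patches. *)
Definition left_of : seq (seq nat) :=
  Eval vm_compute in [seq [seq a <- nums | hmatch a b] | b <- nums].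
Definition below : seq (seq nat) :=
  Eval vm_compute in [seq [seq a <- nums | vmatch a b] | b <- nums].

Lemma left_ofP a b : a \in nums -> b \in nums ->
  hmatch a b -> a \in nth [::] left_of b.
Proof.
move=> an bn; pose P a b := hmatch a b ==> (a \in nth [::] left_of b).
have H : all (fun a => all (P a) nums) nums by vm_compute.
exact: (implyP (all2_nums H an bn)).
Qed.

Lemma belowP a b : a \in nums -> b \in nums ->
  vmatch a b -> a \in nth [::] below b.
Proof.
move=> an bn; pose P a b := vmatch a b ==> (a \in nth [::] below b).
have H : all (fun a => all (P a) nums) nums by vm_compute.
exact: (implyP (all2_nums H an bn)).
Qed.

(** The lists [cs] are the constraints coming from the row above; a row is built
    from its right end. *)
Fixpoint rows (cs : seq (seq nat)) : seq (seq nat) :=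
  if cs is c :: cs' then
    flatten [seq [seq a :: s | a <- c & if s is b :: _ then a \in nth [::] left_of b
                                        else true] | s <- rows cs']
  else [:: [::]].

(** A patch is the list of its [n] rows from bottom to top; it is built from the
    top row downwards. *)
Fixpoint windows (m n : nat) : seq (seq (seq nat)) :=
  if n is n'.+1 then
    flatten [seq [seq r :: w | r <- rows (if w is r' :: _ then
        [seq nth [::] below b | b <- r'] else nseq m nums)] | w <- windows m n']
  else [:: [::]].

Section WindowsComplete.
Variable t : nat -> nat -> nat.
Hypothesis t_in : forall i j, t i j \in nums.
Hypothesis t_hmatch : forall i j, hmatch (t i j) (t i.+1 j).
Hypothesis t_vmatch : forall i j, vmatch (t i j) (t i j.+1).

Lemma rows_complete (cs : seq (seq nat)) i0 j :
  (forall i, (i < size cs)%N -> t (i0 + i) j \in nth [::] cs i) ->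
  [seq t i j | i <- iota i0 (size cs)] \in rows cs.
Proof.
elim: cs i0 => [|c cs IH] i0 H //=.
apply/flattenP; eexists.
  apply/mapP; exists [seq t i j | i <- iota i0.+1 (size cs)]; last by [].
  by apply: IH => i ics; rewrite addSnnS; apply: H.
apply/mapP; exists (t i0 j) => //; rewrite mem_filter.
have := H 0%N isT; rewrite addn0 /= => ->; rewrite andbT.
by case: (size cs) => //= k; apply: left_ofP.
Qed.

Lemma windows_complete m n j0 :
  [seq [seq t i j | i <- iota 0 m] | j <- iota j0 n] \in windows m n.
Proof.
elim: n j0 => [|n IH] j0 //=.
apply/flattenP; eexists.
  by apply/mapP; exists [seq [seq t i j | i <- iota 0 m] | j <- iota j0.+1 n].
apply/mapP; exists [seq t i j0 | i <- iota 0 m] => //.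
case: n {IH} => [|n] /=.
  have := @rows_complete (nseq m nums) 0 j0; rewrite size_nseq; apply=> i im.
  by rewrite nth_nseq im.
set cs := [seq nth [::] below b | b <- _].
have sz : size cs = m by rewrite !size_map size_iota.
have := @rows_complete cs 0 j0; rewrite sz; apply=> i im.
rewrite (nth_map 0%N) ?size_map ?size_iota // (nth_map 0%N) ?size_iota //.
by rewrite nth_iota // add0n belowP.
Qed.
End WindowsComplete.

(** The lower left, lower right, upper left and upper right tiles. *)
Definition quad : Type := (nat * nat * nat * nat)%type.

Definition quad_at (c : nat -> nat -> nat) (i j : nat) : quad :=
  (c i j, c i.+1 j, c i j.+1, c i.+1 j.+1).

Definition window_cell (s : seq (seq nat)) (i j : nat) : nat :=
  nth 0%N (nth [::] s j) i.

(** The squares of side 2 at position [(1, 1)] of legal patches of shape [(5, 4)];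
    these are exactly the 50 squares that occur in tilings.  On smaller patches
    some squares that occur in no tiling survive. *)
Definition quads : seq quad :=
  Eval vm_compute in undup [seq quad_at (window_cell s) 1 1 | s <- windows 5 4].

(** What the surroundings of a cell force at that cell.  It is at [(1, 1)], so that it
    sees one column on its left, three on its right, one row below and two above. *)
Definition window_ok (s : seq (seq nat)) : bool :=
  let c := window_cell s in
  [&& ~~ (narrow (c 1 1) && narrow (c 2 1)), ~~ (short (c 1 1) && short (c 1 2)),
      ~~ narrow (c 1 1) && ~~ short (c 1 1) ==>
        has (fun a => [&& narrow a == ~~ narrow (c 2 1), short a == ~~ short (c 1 2)
             & forall_cells a (fun i j => img_cell a i j == c i.+1 j.+1)]) nums
    & quad_at c 1 1 \in quads]%N.

Lemma windows_ok : all window_ok (windows 5 4).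
Proof. by vm_compute. Qed.

Definition composite (a b c d i j : nat) : nat :=
  if (i < img_width a)%N then
    if (j < img_height a)%N then img_cell a i j
    else img_cell c i (j - img_height a)
  else
    if (j < img_height a)%N then img_cell b (i - img_width a) j
    else img_cell d (i - img_width a) (j - img_height a).

(** The squares of side 2 in the image of a square whose lower left cell is in the
    image of its lower left tile.  Every square of an image arises in this way. *)
Definition children (Q : quad) : seq quad :=
  let: (a, b, c, d) := Q in
  [seq quad_at (composite a b c d) i j
     | i <- iota 0 (img_width a), j <- iota 0 (img_height a)].

Fixpoint descends (n : nat) (Q R : quad) : bool :=
  if n is n'.+1 then has (fun Q' => descends n' Q' R) (children Q) else Q == R.

(** Passing through one square reduces the verification that any square leads to
    any other to two lists of 50 searches. *)
Definition hub : quad := (8, 16, 9, 14)%N.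

Lemma quads_to_hub : all (fun Q => descends 6 Q hub) quads.
Proof. by vm_compute. Qed.

Lemma hub_to_quads : all (descends 6 hub) quads.
Proof. by vm_compute. Qed.

(** * The substitution on tilings *)

Definition omega_letter (a : tile) : word tile :=
  @Word tile (img_width (num a)) (img_height (num a))
    [ffun ij : 'I_(img_width (num a)) * 'I_(img_height (num a)) =>
       tile_of (img_cell (num a) ij.1 ij.2)].

Lemma addzS (k : int) (i : nat) : k + i%:Z + 1 = k + i.+1%:Z.
Proof. by rewrite -addrA -PoszD addn1. Qed.

Definition omega : morphism2 tile := induced_mor omega_letter.

Lemma img_width_gt0 a : (0 < img_width a)%N.
Proof. by rewrite /img_width; case: ifP. Qed.

Lemma img_height_gt0 a : (0 < img_height a)%N.
Proof. by rewrite /img_height; case: ifP. Qed.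

Lemma omega_nonempty a : nonempty_word (omega_letter a).
Proof. by rewrite /nonempty_word img_width_gt0 img_height_gt0. Qed.

Lemma cell_at_omega a i j :
  (i < img_width (num a))%N -> (j < img_height (num a))%N ->
  cell_at (omega_letter a) i j = Some (tile_of (img_cell (num a) i j)).
Proof.
move=> iw jh.
by rewrite (@cell_at_ord _ (omega_letter a) (Ordinal iw) (Ordinal jh)) /= ffunE.
Qed.

Definition code (x : config tile) (k l : int) : nat := num (x (pt k l)).

Lemma code_in x k l : code x k l \in nums. Proof. exact: num_in. Qed.

Lemma wang_shiftP (x : config tile) : wang_shift U x <->
  forall k l, hmatch (code x k l) (code x (k + 1) l) /\
              vmatch (code x k l) (code x k (l + 1)).
Proof.
have E (n m : int * int) : hmatch (num (x n)) (num (x m)) =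
    (right (ssval (x n)) == left (ssval (x m))).
  by rewrite /hmatch !u_num.
have E' (n m : int * int) : vmatch (num (x n)) (num (x m)) =
    (top (ssval (x n)) == bottom (ssval (x m))).
  by rewrite /vmatch !u_num.
split=> H.
  move=> k l; have [h v] := H (pt k l); rewrite /code E E' -pt_e1 -pt_e2.
  by split; apply/eqP.
case=> k l; have := H k l; rewrite /code E E' -pt_e1 -pt_e2.
by case=> /eqP ? /eqP.
Qed.

Lemma inflatesP D (x y : config tile) p q : inflates omega_letter D x p q y <->
  forall k l, D (pt k l) ->
  [/\ p (k + 1) = p k + (img_width (code x k l))%:Z,
      q (l + 1) = q l + (img_height (code x k l))%:Z &
      forall i j : nat,
        (i < img_width (code x k l))%N -> (j < img_height (code x k l))%N ->
        code y (p k + i%:Z) (q l + j%:Z) = img_cell (code x k l) i j].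
Proof.
split=> H k l Dkl; have [pE qE C] := H k l Dkl; split=> // i j.
  move=> iw jh; rewrite {1}/code (C _ _ _ (cell_at_omega iw jh)) num_tile_of //.
  by have [] := img_cellP (code_in x k l) iw jh.
move=> a Ha; have [/= iw jh] := cell_at_bounds Ha.
apply: num_inj; rewrite [LHS](C i j iw jh).
move: Ha; rewrite cell_at_omega // => -[<-]; rewrite num_tile_of //.
by have [] := img_cellP (code_in x k l) iw jh.
Qed.

Section LocalFacts.
Variable x : config tile.
Hypothesis Xx : wang_shift U x.
Let t := code x.

Lemma hmatchX k l : hmatch (t k l) (t (k + 1) l).
Proof. by have [] := (wang_shiftP x).1 Xx k l. Qed.

Lemma vmatchX k l : vmatch (t k l) (t k (l + 1)).
Proof. by have [] := (wang_shiftP x).1 Xx k l. Qed.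

Lemma short_row k l : short (t k l) = short (t 0 l).
Proof.
move: k; apply: int_step_ind => // k.
by rewrite (hmatch_short (code_in _ _ _) (code_in _ _ _) (hmatchX k l)).
Qed.

Lemma narrow_col k l : narrow (t k l) = narrow (t k 0).
Proof.
move: l; apply: int_step_ind => // l.
by rewrite (vmatch_narrow (code_in _ _ _) (code_in _ _ _) (vmatchX k l)).
Qed.

Lemma window_at k l : window_ok
  [seq [seq t (k - 1 + i%:Z) (l - 1 + j%:Z) | i <- iota 0 5] | j <- iota 0 4].
Proof.
have /allP := windows_ok; apply.
pose tw (i j : nat) := t (k - 1 + i%:Z) (l - 1 + j%:Z).
apply: (@windows_complete tw _ _ _ 5 4 0); rewrite /tw.
- by move=> i j; apply: code_in.
- by move=> i j; have := hmatchX (k - 1 + i%:Z) (l - 1 + j%:Z); rewrite addzS.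
- by move=> i j; have := vmatchX (k - 1 + i%:Z) (l - 1 + j%:Z); rewrite addzS.
Qed.

Lemma window_facts k l :
  [/\ ~~ (narrow (t k l) && narrow (t (k + 1) l)),
      ~~ (short (t k l) && short (t k (l + 1))),
      ~~ narrow (t k l) -> ~~ short (t k l) ->
        exists2 a, a \in nums & [/\ narrow a = ~~ narrow (t (k + 1) l),
          short a = ~~ short (t k (l + 1)) &
          forall i j : nat, (i < img_width a)%N -> (j < img_height a)%N ->
            img_cell a i j = t (k + i%:Z) (l + j%:Z)] &
      (t k l, t (k + 1) l, t k (l + 1), t (k + 1) (l + 1)) \in quads].
Proof.
set s := [seq [seq t (k - 1 + i%:Z) (l - 1 + j%:Z) | i <- iota 0 5] | j <- iota 0 4].
have cE (i j : nat) : (i < 2)%N -> (j < 2)%N ->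
    window_cell s i.+1 j.+1 = t (k + i%:Z) (l + j%:Z).
  move=> i2 j2; rewrite /window_cell (nth_map 0%N) ?size_iota; last by lia.
  rewrite (nth_map 0%N) ?size_iota; last by lia.
  by rewrite !nth_iota; [congr (t _ _)|..]; lia.
have := window_at k l; rewrite -/s /window_ok /quad_at.
rewrite (cE 0%N 0%N) // (cE 1%N 0%N) // (cE 0%N 1%N) // (cE 1%N 1%N) // !addr0.
case/and4P => nn ss dec qd; split=> // nk sk.
move: dec; rewrite nk sk => /hasP[a an /and3P[/eqP na /eqP sa fits]].
exists a => //; split=> // i j iw jh; rewrite -cE.
- exact/eqP/(forall_cellsP fits).
- by move: iw; rewrite /img_width; case: ifP => _ /leq_trans; apply.
- by move: jh; rewrite /img_height; case: ifP => _ /leq_trans; apply.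
Qed.
End LocalFacts.

(** * Desubstitution *)

(** The next element of a set of integers that meets every pair of consecutive
    integers. *)
Definition next_start (S : int -> bool) (z : int) : int :=
  if S (z + 1) then z + 1 else z + 2.

Definition enumerates (S : int -> bool) (p : int -> int) : Prop :=
  forall k, S (p k) /\ p (k + 1) = next_start S (p k).

(** Iterates [next_start] to the right, and the symmetric function to the left, from
    one of the points 0 and 1. *)
Lemma enumerates_exists (S : int -> bool) :
  (forall k, S k || S (k + 1)) -> exists p, enumerates S p.
Proof.
move=> SS.
(* One of any two consecutive integers is in [S], so a gap has length 1 or 2. *)
pose prev z := if S (z - 1) then z - 1 else z - 2.
pose s0 : int := if S 0 then 0 else 1.
have Ss0 : S s0 by rewrite /s0; have := SS 0; rewrite add0r; case: ifP.
have Sn z : S (next_start S z).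
  rewrite /next_start; case: ifP => // n1; have := SS (z + 1); rewrite n1 /=.
  by rewrite -addrA.
have Sp z : S (prev z).
  rewrite /prev; case: ifP => // n1; have := SS (z - 2).
  have -> : z - 2 + 1 = z - 1 by lia.
  by rewrite n1 orbF.
have np z : S z -> next_start S (prev z) = z.
  rewrite /prev => Sz; case: ifP => n1; rewrite /next_start.
    by rewrite subrK Sz.
  have -> : z - 2 + 1 = z - 1 by lia.
  by rewrite n1 subrK.
exists (fun k => match k with Posz n => iter n (next_start S) s0
                        | Negz n => iter n.+1 prev s0 end).
case=> [n|[|n]]; split=> //.
- by case: n => //= n; apply: Sn.
- by rewrite -PoszD addn1.
- by rewrite -[LHS]/s0 np.
- exact: Sp.
have -> : Negz n.+1 + 1 = Negz n by lia.
by rewrite [RHS]np //; apply: Sp.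
Qed.

Lemma next_start_inj (S : int -> bool) z z' :
  S z -> S z' -> next_start S z = next_start S z' -> z = z'.
Proof.
rewrite /next_start => Sz Sz'.
case: ifP => h; case: ifP => h' E; try lia.
- by move: h'; have <- : z = z' + 1 by [lia]; rewrite Sz.
- by move: h; have <- : z' = z + 1 by [lia]; rewrite Sz'.
Qed.

(** Two enumerations meet, because one of them visits the value of the other at 0,
    and then agree in both directions because [next_start] is injective. *)
Lemma enumerates_uniq (S : int -> bool) p p' : enumerates S p -> enumerates S p' ->
  exists s, forall k, p' k = p (k + s).
Proof.
move=> Ep Ep'.
have [|s /andP[s1 s2]] := @cuts_cover p _ (p' 0).
  by move=> k; have [_ ->] := Ep k; rewrite /next_start; case: ifP; lia.
exists s; apply: int_step_ind => [|k].
  rewrite add0r; have [_ pE] := Ep s; have [S0 _] := Ep' 0.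
  move: s2; rewrite pE /next_start; case: ifP => h s2; first by lia.
  have [//|E] : p' 0 = p s \/ p' 0 = p s + 1 by lia.
  by rewrite -E S0 in h.
have [Sk pE] := Ep (k + s); have [Sk' pE'] := Ep' k.
have -> : k + 1 + s = k + s + 1 by lia.
by rewrite pE pE'; split=> [->//|]; apply: next_start_inj.
Qed.

Definition col_start (y : config tile) (k : int) : bool := ~~ narrow (code y k 0).
Definition row_start (y : config tile) (l : int) : bool := ~~ short (code y 0 l).

(** The blocks start at the columns that are not narrow and at the rows that are
    not short; their sides carry the colours of the tiles they come from. *)
Lemma desubstitution (y : config tile) : wang_shift U y ->
  exists (x : config tile) p q, wang_shift U x /\ inflates omega_letter setT x p q y.
Proof.
move=> Xy; pose t := code y.
have [|p Ep] := @enumerates_exists (col_start y).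
  by move=> k; have [+ _ _ _] := window_facts Xy k 0; rewrite negb_and.
have [|q Eq] := @enumerates_exists (row_start y).
  by move=> l; have [_ + _ _] := window_facts Xy 0 l; rewrite negb_and.
have dec (n : int * int) : exists a, [/\ a \in nums,
    narrow a = col_start y (p n.1 + 1), short a = row_start y (q n.2 + 1) &
    forall i j : nat, (i < img_width a)%N -> (j < img_height a)%N ->
      img_cell a i j = t (p n.1 + i%:Z) (q n.2 + j%:Z)].
  have [_ _ +  _] := window_facts Xy (p n.1) (q n.2).
  rewrite (narrow_col Xy) (short_row Xy) -/(col_start _ _) -/(row_start _ _).
  move=> /(_ (Ep _).1 (Eq _).1) [a an [na sa H]]; exists a; split=> //.
    by rewrite na (narrow_col Xy).
  by rewrite sa (short_row Xy).
have {dec}[a aP] := choice dec.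
pose x : config tile := fun n => tile_of (a n).
have xE k l : code x k l = a (pt k l).
  by rewrite /code num_tile_of //; have [] := aP (pt k l).
have pE k l : p (k + 1) = p k + (img_width (code x k l))%:Z.
  have [_ ->] := Ep k; have [_ na _ _] := aP (pt k l).
  by rewrite xE /next_start /img_width na; case: ifP.
have qE k l : q (l + 1) = q l + (img_height (code x k l))%:Z.
  have [_ ->] := Eq l; have [_ _ sa _] := aP (pt k l).
  by rewrite xE /next_start /img_height sa; case: ifP.
have inf : inflates omega_letter setT x p q y.
  apply/inflatesP => k l _; split=> // i j iw jh.
  by have [_ _ _ H] := aP (pt k l); rewrite xE in iw jh *; rewrite H.
exists x, p, q; split=> //; apply/wang_shiftP => k l.
have /inflatesP I := inf; have [pk qk C] := I k l Logic.I.
split.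
  have [_ qk' C'] := I (k + 1) l Logic.I.
  have eh : img_height (code x k l) = img_height (code x (k + 1) l) by lia.
  rewrite hmatch_img ?code_in // eh eqxx; apply/allP => j.
  rewrite mem_iota add0n => jh; rewrite -C ?eh ?prednK ?img_width_gt0 //.
  rewrite -C' ?img_width_gt0 // pk addr0.
  have := hmatchX Xy (p k + (img_width (code x k l)).-1%:Z) (q l + j%:Z).
  by rewrite addzS prednK ?img_width_gt0.
have [pk' _ C'] := I k (l + 1) Logic.I.
have ew : img_width (code x k l) = img_width (code x k (l + 1)) by lia.
rewrite vmatch_img ?code_in // ew eqxx; apply/allP => i.
rewrite mem_iota add0n => iw; rewrite -C ?ew ?prednK ?img_height_gt0 //.
rewrite -C' ?img_height_gt0 // qk addr0.
have := vmatchX Xy (p k + i%:Z) (q l + (img_height (code x k l)).-1%:Z).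
by rewrite addzS prednK ?img_height_gt0.
Qed.

(** * Legality of images *)

(** Only the pairs of adjacent cells that both lie in [D] are constrained. *)
Definition legal_on (D : set (int * int)) (x : config tile) : Prop :=
  forall k l, D (pt k l) ->
    (D (pt (k + 1) l) -> hmatch (code x k l) (code x (k + 1) l)) /\
    (D (pt k (l + 1)) -> vmatch (code x k l) (code x k (l + 1))).

Lemma legal_setT x : legal_on setT x <-> wang_shift U x.
Proof.
split=> [H|/wang_shiftP H k l _]; last by split=> _; apply H.
by apply/wang_shiftP => k l; have [h v] := H k l I; split; [apply: h | apply: v].
Qed.

(** Two adjacent cells of the image lie in one block, which is legal, or on the
    two sides of a cut, where adjacency comes from that of the original tiles. *)
Lemma image_hmatch D x p q y k l (i j : nat) :
  inflates omega_letter D x p q y -> D (pt k l) ->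
  (i < img_width (code x k l))%N -> (j < img_height (code x k l))%N ->
  ((i.+1 < img_width (code x k l))%N \/
    D (pt (k + 1) l) /\ hmatch (code x k l) (code x (k + 1) l)) ->
  hmatch (code y (p k + i%:Z) (q l + j%:Z)) (code y (p k + i%:Z + 1) (q l + j%:Z)).
Proof.
move=> /inflatesP H Dkl iw jh; have [pE _ C] := H k l Dkl.
have [in_ _] := img_internal (code_in x k l) iw jh.
case: (ltnP i.+1 (img_width (code x k l))) => [iw' _|iw' [//|[Dkl' h]]].
  by rewrite addzS !C //; apply: in_.
have [_ _ C'] := H (k + 1) l Dkl'.
have iE : i.+1 = img_width (code x k l) by lia.
rewrite addzS iE -pE -[p (k + 1)]addr0.
move: h; rewrite hmatch_img ?code_in // => /andP[/eqP eh /allP /(_ j)].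
rewrite mem_iota add0n C // (C' 0%N) -?eh ?img_width_gt0 // -iE; exact.
Qed.

Lemma image_vmatch D x p q y k l (i j : nat) :
  inflates omega_letter D x p q y -> D (pt k l) ->
  (i < img_width (code x k l))%N -> (j < img_height (code x k l))%N ->
  ((j.+1 < img_height (code x k l))%N \/
    D (pt k (l + 1)) /\ vmatch (code x k l) (code x k (l + 1))) ->
  vmatch (code y (p k + i%:Z) (q l + j%:Z)) (code y (p k + i%:Z) (q l + j%:Z + 1)).
Proof.
move=> /inflatesP H Dkl iw jh; have [_ qE C] := H k l Dkl.
have [_ in_] := img_internal (code_in x k l) iw jh.
case: (ltnP j.+1 (img_height (code x k l))) => [jh' _|jh' [//|[Dkl' v]]].
  by rewrite addzS !C //; apply: in_.
have [_ _ C'] := H k (l + 1) Dkl'.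
have jE : j.+1 = img_height (code x k l) by lia.
rewrite addzS jE -qE -[q (l + 1)]addr0.
move: v; rewrite vmatch_img ?code_in // => /andP[/eqP ew /allP /(_ i)].
rewrite mem_iota add0n C // (C' _ 0%N) -?ew ?img_height_gt0 // -jE; exact.
Qed.

Lemma image_legal x p q y : inflates omega_letter setT x p q y ->
  wang_shift U x -> wang_shift U y.
Proof.
move=> inf /wang_shiftP Xx; apply/wang_shiftP => I J.
have [k [l [i [j [[-> ->] iw jh]]]]] := inflates_cover omega_nonempty inf (pt I J).
split; [apply: (image_hmatch inf) | apply: (image_vmatch inf)] => //;
  by right; split=> //; have [] := Xx k l.
Qed.

Lemma shift_legal n x : wang_shift U x -> wang_shift U (shift n x).
Proof.
move=> Xx m; have [h v] := Xx (m + n); rewrite /shift.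
by rewrite !(addrAC m _ n).
Qed.

(** * Recognizability and aperiodicity *)

(** The right columns of the blocks are narrow and the left ones are not, and
    similarly for rows, so that the cuts can be recognized in the image. *)
Lemma cuts_enumerate x p q y :
  wang_shift U y -> inflates omega_letter setT x p q y ->
  enumerates (col_start y) p /\ enumerates (row_start y) q.
Proof.
move=> Xy /inflatesP H; split=> k.
  have [pE qE C] := H k 0 I; have [pE' qE' C'] := H (k + 1) 0 I.
  rewrite /next_start /col_start -!(narrow_col Xy _ (q 0)).
  have E : narrow (code y (p k) (q 0)) = false.
    rewrite -[p k]addr0 -[q 0]addr0 (C 0%N 0%N) ?img_width_gt0 ?img_height_gt0 //.
    by have [] := img_cellP (code_in x k 0) (img_width_gt0 _) (img_height_gt0 _).
  have E' : narrow (code y (p (k + 1)) (q 0)) = false.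
    rewrite -[p (k + 1)]addr0 -[q 0]addr0 (C' 0%N 0%N) ?img_width_gt0 ?img_height_gt0 //.
    by have [] := img_cellP (code_in x (k + 1) 0) (img_width_gt0 _) (img_height_gt0 _).
  rewrite E; split=> //; case: ifP => N.
    rewrite pE; have : img_width (code x k 0) != 2%N;
      last by rewrite /img_width; case: ifP.
    apply/eqP => w2; move: N; rewrite -[q 0]addr0 (C 1%N 0%N) ?w2 ?img_height_gt0 //.
    have [|_ -> _ //] := @img_cellP (code x k 0) 1 0 (code_in x k 0) _ (img_height_gt0 _).
    by rewrite w2.
  rewrite pE; have : img_width (code x k 0) != 1%N;
    last by rewrite /img_width; case: ifP.
  by apply/eqP => w1; move: N; rewrite -[1]/(1%:Z) -{1}w1 -pE E'.
have [pE qE C] := H 0 k I; have [pE' qE' C'] := H 0 (k + 1) I.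
rewrite /next_start /row_start -!(short_row Xy (p 0)).
have E : short (code y (p 0) (q k)) = false.
  rewrite -[p 0]addr0 -[q k]addr0 (C 0%N 0%N) ?img_width_gt0 ?img_height_gt0 //.
  by have [] := img_cellP (code_in x 0 k) (img_width_gt0 _) (img_height_gt0 _).
have E' : short (code y (p 0) (q (k + 1))) = false.
  rewrite -[p 0]addr0 -[q (k + 1)]addr0 (C' 0%N 0%N) ?img_width_gt0 ?img_height_gt0 //.
  by have [] := img_cellP (code_in x 0 (k + 1)) (img_width_gt0 _) (img_height_gt0 _).
rewrite E; split=> //; case: ifP => N.
  rewrite qE; have : img_height (code x 0 k) != 2%N;
    last by rewrite /img_height; case: ifP.
  apply/eqP => h2; move: N; rewrite -[p 0]addr0 (C 0%N 1%N) ?h2 ?img_width_gt0 //.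
  have [|_ _ -> //] := @img_cellP (code x 0 k) 0 1 (code_in x 0 k) (img_width_gt0 _).
  by rewrite h2.
rewrite qE; have : img_height (code x 0 k) != 1%N;
  last by rewrite /img_height; case: ifP.
by apply/eqP => h1; move: N; rewrite -[1]/(1%:Z) -{1}h1 -qE E'.
Qed.

(** The cuts are recognized by [cuts_enumerate], and then the tiles, because their
    images are distinct. *)
Lemma recognizability x p q x' p' q' y : wang_shift U y ->
  inflates omega_letter setT x p q y -> inflates omega_letter setT x' p' q' y ->
  exists s r, [/\ forall k, p' k = p (k + s), forall l, q' l = q (l + r)
    & forall k l, code x' k l = code x (k + s) (l + r)].
Proof.
move=> Xy inf inf'.
have [Ep Eq] := cuts_enumerate Xy inf; have [Ep' Eq'] := cuts_enumerate Xy inf'.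
have [s Es] := enumerates_uniq Ep Ep'; have [r Er] := enumerates_uniq Eq Eq'.
exists s, r; split=> // k l.
move: inf inf' => /inflatesP H /inflatesP H'.
have [pE qE C] := H (k + s) (l + r) I; have [pE' qE' C'] := H' k l I.
have ks : k + 1 + s = k + s + 1 by lia.
have lr : l + 1 + r = l + r + 1 by lia.
rewrite !Es ks in pE'; rewrite !Er lr in qE'.
have ew : img_width (code x' k l) = img_width (code x (k + s) (l + r)) by lia.
have eh : img_height (code x' k l) = img_height (code x (k + s) (l + r)) by lia.
apply: img_inj; rewrite ?code_in // => i j iw jh.
by rewrite -C' // Es Er C -?ew -?eh.
Qed.

Lemma wide_column x : wang_shift U x -> exists k, ~~ narrow (code x k 0).
Proof.
move=> Xx; have [+ _ _ _] := window_facts Xx 0 0; rewrite negb_and.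
by case/orP; [exists 0 | exists (0 + 1)].
Qed.

Lemma tall_row x : wang_shift U x -> exists l, ~~ short (code x 0 l).
Proof.
move=> Xx; have [_ + _ _] := window_facts Xx 0 0; rewrite negb_and.
by case/orP; [exists 0 | exists (0 + 1)].
Qed.

(** A translation by [v] moves the cuts by [s] places; the distance [v] is the sum
    of the widths of [s] consecutive blocks, and some choice of these blocks
    includes one of width 2. *)
Lemma period_shrinks (p : int -> int) k0 s v : (forall k, p k < p (k + 1)) ->
  p (k0 + 1) = p k0 + 2 -> (forall k, p k + v = p (k + s)) ->
  (v = 0 /\ s = 0) \/ (s != 0 /\ (`|s| < `|v|)%N).
Proof.
move=> pS wide per; have grow := cuts_growth pS.
have [s0|s0|s0] := ltrgtP s 0.
- (* The blocks [k0], ..., [k0 - s - 1], the first of which has width 2. *)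
  right; split; first by lia.
  have := per (k0 - s); rewrite subrK => E.
  have := grow (k0 + 1) (`|s| - 1)%N.
  have -> : k0 + 1 + (`|s| - 1)%N%:Z = k0 - s by lia.
  by rewrite wide; lia.
- (* The blocks [k0], ..., [k0 + s - 1]. *)
  right; split; first by lia.
  have E := per k0; have := grow (k0 + 1) (`|s| - 1)%N.
  have -> : k0 + 1 + (`|s| - 1)%N%:Z = k0 + s by lia.
  by rewrite wide -E; lia.
by left; have := per 0; rewrite s0 addr0; lia.
Qed.

(** Infinite descent on the size of the period. *)
Lemma no_period n (y : config tile) v1 v2 : wang_shift U y ->
  (`|v1| + `|v2| <= n)%N -> shift (pt v1 v2) y = y -> v1 = 0 /\ v2 = 0.
Proof.
elim: n y v1 v2 => [|n IH] y v1 v2 Xy vn per; first by lia.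
have [x [p [q [Xx inf]]]] := desubstitution Xy.
(* The same tiling with all the cuts translated by the period. *)
have inf' : inflates omega_letter setT x (fun k => p k + v1) (fun l => q l + v2) y.
  move=> k l _; have [pE qE C] := inf k l I.
  split=> [||i j a Ha]; rewrite ?pE ?qE 1?addrAC //.
  rewrite -(C _ _ _ Ha) -[in RHS]per /shift ptD.
  by congr (y (pt _ _)); rewrite addrAC.
have [s [r [Es Er Ec]]] := recognizability Xy inf inf'.
have [pS qS] := inflates_cuts omega_nonempty inf.
have [k0 wk0] := wide_column Xx; have [l0 tl0] := tall_row Xx.
have /inflatesP H := inf.
have pk0 : p (k0 + 1) = p k0 + 2.
  by have [-> _ _] := H k0 0 I; rewrite /img_width (negbTE wk0).
have ql0 : q (l0 + 1) = q l0 + 2.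
  by have [_ -> _] := H 0 l0 I; rewrite /img_height (negbTE tl0).
have perx : shift (pt s r) x = x.
  by apply: funext => -[k l]; apply: num_inj; rewrite /shift ptD [RHS]Ec.
have A := period_shrinks pS pk0 Es; have B := period_shrinks qS ql0 Er.
case: A B => [[v10 s0]|[s0 sv]] [[v20 r0]|[r0 rv]] //;
  by have [] := IH x s r Xx _ perx; lia.
Qed.

(** * Growth of the iterates *)

Lemma cuts_lt (p : int -> int) : (forall k, p k < p (k + 1)) ->
  forall k k', p k < p k' -> k < k'.
Proof.
move=> pS k k' lt; rewrite ltNge; apply/negP => kk.
have := cuts_growth pS k' `|k - k'|%N.
have -> : k' + `|k - k'|%N%:Z = k by lia.
by lia.
Qed.

(** Block widths are read off the bottom row and block heights off the left
    column of the rectangle; by legality they are right in all of it. *)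
Lemma inflates_exists a b (x : config tile) : legal_on (rect 0 0 a b) x ->
  exists (y : config tile) p q, [/\ p 0 = 0, q 0 = 0,
    forall k, p k < p (k + 1), forall l, q l < q (l + 1) &
    inflates omega_letter (rect 0 0 a b) x p q y].
Proof.
move=> leg.
pose p := offset (fun k => img_width (code x k 0)).
pose q := offset (fun l => img_height (code x 0 l)).
have pE k : p (k + 1) = p k + (img_width (code x k 0))%:Z by apply: offsetS.
have qE l : q (l + 1) = q l + (img_height (code x 0 l))%:Z by apply: offsetS.
have pS k : p k < p (k + 1) by rewrite pE; have := img_width_gt0 (code x k 0); lia.
have qS k : q k < q (k + 1) by rewrite qE; have := img_height_gt0 (code x 0 k); lia.
have [col colP] := choice (cuts_cover pS); have [row rowP] := choice (cuts_cover qS).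
have colE k I : p k <= I < p (k + 1) -> col I = k.
  move=> kI; have cI := colP I.
  have := @cuts_lt p pS k (col I + 1); have := @cuts_lt p pS (col I) (k + 1).
  by lia.
have rowE l J : q l <= J < q (l + 1) -> row J = l.
  move=> lJ; have rJ := rowP J.
  have := @cuts_lt q qS l (row J + 1); have := @cuts_lt q qS (row J) (l + 1).
  by lia.
pose y : config tile := fun n => tile_of
  (img_cell (code x (col n.1) (row n.2))
     `|(n.1 - p (col n.1))%R| `|(n.2 - q (row n.2))%R|).
exists y, p, q; split; [exact: offset0 | exact: offset0 | exact: pS | exact: qS |].
apply/inflatesP => k l kl.
(* The legality of the rectangle carries widths up the columns from row 0. *)
have ew : img_width (code x k l) = img_width (code x k 0).
  have [m lE] : exists m : nat, l = m%:Z.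
    by exists `|l|%N; move: kl; rewrite /rect /=; lia.
  rewrite {}lE in kl *; elim: m kl => [//|m IH] kl.
  have kl' : rect 0 0 a b (pt k m%:Z) by move: kl; rewrite /rect /=; lia.
  rewrite -IH // /img_width; have [_] := leg k m kl'.
  have -> : m%:Z + 1 = m.+1%:Z by lia.
  by move=> /(_ kl) /vmatch_narrow ->; rewrite ?code_in.
have eh : img_height (code x k l) = img_height (code x 0 l).
  have [m lE] : exists m : nat, k = m%:Z.
    by exists `|k|%N; move: kl; rewrite /rect /=; lia.
  rewrite {}lE in kl ew *; elim: m kl {ew} => [//|m IH] kl.
  have kl' : rect 0 0 a b (pt m%:Z l) by move: kl; rewrite /rect /=; lia.
  rewrite -IH // /img_height; have [+ _] := leg m l kl'.
  have -> : m%:Z + 1 = m.+1%:Z by lia.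
  by move=> /(_ kl) /hmatch_short ->; rewrite ?code_in.
split=> [||i j iw jh]; rewrite ?ew ?eh //.
have cE : col (p k + i%:Z) = k by apply: colE; rewrite pE -ew; lia.
have rE : row (q l + j%:Z) = l by apply: rowE; rewrite qE -eh; lia.
rewrite [LHS]/code /y /= cE rE.
have -> : `|(p k + i%:Z - p k)%R|%N = i by lia.
have -> : `|(q l + j%:Z - q l)%R|%N = j by lia.
by rewrite num_tile_of //; have [] := img_cellP (code_in x k l) iw jh.
Qed.

Lemma omega_crop x p q y k l a b :
  inflates omega_letter (rect k l a b) x p q y -> (0 < a)%N -> (0 < b)%N ->
  exists a' b', [/\ p (k + a%:Z) = p k + a'%:Z, q (l + b%:Z) = q l + b'%:Z &
    mor omega (crop x k l a b) = Some (crop y (p k) (q l) a' b')].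
Proof.
move=> inf a0 b0; have [a' [b' [pE qE im]]] := inflates_crop inf a0 b0.
by exists a', b'; split=> //; apply/word_morP.
Qed.

(** The lower left cell of an image is neither narrow nor short, which makes the
    next image strictly larger. *)
Lemma omega_legal a b (x : config tile) : (0 < a)%N -> (0 < b)%N ->
  legal_on (rect 0 0 a b) x ->
  exists (y : config tile) a' b',
    [/\ mor omega (crop x 0 0 a b) = Some (crop y 0 0 a' b'),
        legal_on (rect 0 0 a' b') y,
        ~~ narrow (code y 0 0) && ~~ short (code y 0 0),
        (a + ~~ narrow (code x 0 0) <= a')%N
      & (b + ~~ short (code x 0 0) <= b')%N].
Proof.
move=> a0 b0 leg; have [y [p [q [p0 q0 pS qS inf]]]] := inflates_exists leg.
have [a' [b' [pa qb om_xy]]] := omega_crop inf a0 b0.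
rewrite p0 q0 !add0r in pa qb om_xy.
have /inflatesP H := inf.
have [|pE qE C] := H 0 0; first by rewrite /rect /=; lia.
exists y, a', b'; split=> //.
- move=> I J IJ.
  have [k kI] := cuts_cover pS I; have [l lJ] := cuts_cover qS J.
  have kl : rect 0 0 a b (pt k l).
    have := @cuts_lt p pS 0 (k + 1); have := @cuts_lt p pS k a.
    have := @cuts_lt q qS 0 (l + 1); have := @cuts_lt q qS l b.
    move: IJ; rewrite /rect /= p0 q0 pa qb; lia.
  have [pk ql _] := H k l kl.
  have [i Ii] : exists i : nat, I = p k + i%:Z by exists `|(I - p k)%R|%N; lia.
  have [j Jj] : exists j : nat, J = q l + j%:Z by exists `|(J - q l)%R|%N; lia.
  have iw : (i < img_width (code x k l))%N by lia.
  have jh : (j < img_height (code x k l))%N by lia.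
  have [lh lv] := leg k l kl.
  rewrite Ii Jj in IJ *; split=> IJ'.
    apply: (image_hmatch inf) => //.
    case: (ltnP i.+1 (img_width (code x k l))) => iw'; [by left | right].
    have D : rect 0 0 a b (pt (k + 1) l).
      have := @cuts_lt p pS (k + 1) a; rewrite pk pa.
      move: IJ' kl; rewrite /rect /=; lia.
    by split; last exact: lh.
  apply: (image_vmatch inf) => //.
  case: (ltnP j.+1 (img_height (code x k l))) => jh'; [by left | right].
  have D : rect 0 0 a b (pt k (l + 1)).
    have := @cuts_lt q qS (l + 1) b; rewrite ql qb.
    move: IJ' kl; rewrite /rect /=; lia.
  by split; last exact: lv.
- have := C 0%N 0%N (img_width_gt0 _) (img_height_gt0 _); rewrite p0 q0 !addr0 => ->.
  by have [_ -> ->] := img_cellP (code_in x 0 0) (img_width_gt0 _) (img_height_gt0 _).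
- have := cuts_growth pS 1 a.-1; rewrite -[1](add0r 1) pE p0 !add0r.
  have -> : 1 + a.-1%:Z = a by lia.
  by rewrite pa /img_width; case: narrow => /=; lia.
- have := cuts_growth qS 1 b.-1; rewrite -[1](add0r 1) qE q0 !add0r.
  have -> : 1 + b.-1%:Z = b by lia.
  by rewrite qb /img_height; case: short => /=; lia.
Qed.

Lemma mor_iterS (A : finType) (phi : morphism2 A) m w w' w'' :
  mor_iter phi m w = Some w' -> mor phi w' = Some w'' ->
  mor_iter phi m.+1 w = Some w''.
Proof. by rewrite /mor_iter iterS => ->. Qed.

Lemma mor_iterSr (A : finType) (phi : morphism2 A) m w w' w'' :
  mor phi w = Some w' -> mor_iter phi m w' = w'' -> mor_iter phi m.+1 w = w''.
Proof. by rewrite /mor_iter iterSr /= => ->. Qed.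

(** The rectangle is strictly larger at each step from the second on: a tile may
    itself be narrow or short, but the lower left cell of an image is not. *)
Lemma omega_iter_legal (c : tile) m : exists (x : config tile) a b,
  [/\ mor_iter omega m (letter c) = Some (crop x 0 0 a b),
      legal_on (rect 0 0 a b) x, (maxn 1 m <= a)%N, (maxn 1 m <= b)%N
    & (0 < m)%N -> ~~ narrow (code x 0 0) && ~~ short (code x 0 0)].
Proof.
elim: m => [|m [x [a [b [it leg am bm corner]]]]].
  exists (fun=> c), 1%N, 1%N; split=> //.
  by move=> k l kl; split=> kl'; exfalso; move: kl kl'; rewrite /rect /=; lia.
have [||y [a' [b' [om_xy leg' corner' aa bb]]]] :=
  @omega_legal a b x _ _ leg; try lia.
exists y, a', b'; split=> //.
- exact: mor_iterS it om_xy.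
- case: m corner aa am {it bm} => [|m] corner aa am; first by lia.
  by case/andP: (corner isT) aa => -> _; lia.
- case: m corner bb bm {it am} => [|m] corner bb bm; first by lia.
  by case/andP: (corner isT) bb => _ ->; lia.
Qed.

Lemma omega_expansive : expansive omega.
Proof.
move=> c K; have [x [a [b [it _ aK bK _]]]] := omega_iter_legal c K.+1.
by exists K.+1, (crop x 0 0 a b); rewrite it leq_min /=; split=> //; lia.
Qed.

(** * Existence of tilings and self-similarity *)

Lemma closed_legal_on D : closed (legal_on D).
Proof.
move=> x clx k l Dkl.
pose same (n : int * int) : set (config tile) := [set y | y n = x n].
have [|y [leg [ykl [yk yl]]]] := clx (same (pt k l) `&`
    (same (pt (k + 1) l) `&` same (pt k (l + 1)))).
  by do !apply: filterI; apply: nbhs_coord.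
have [h v] := leg k l Dkl.
by move: h v; rewrite /code ykl yk yl.
Qed.

Lemma subshift_U : subshift (wang_shift U).
Proof.
split; last by move=> n x; apply: shift_legal.
have -> : wang_shift U = legal_on setT by apply/seteqP; split=> x /legal_setT.
exact: closed_legal_on.
Qed.

(** The squares given by [omega_iter_legal], recentred, are legal on larger and
    larger boxes. *)
Lemma wang_shift_nonempty : wang_shift U !=set0.
Proof.
have [||r s rs x leg|x Hx] :=
  @compact_approx _ (fun r => legal_on [set n | box r n]).
- by move=> r; apply: closed_legal_on.
- move=> r.
  have [x [a [b [_ leg ar br _]]]] := omega_iter_legal (tile_of 0) (2 * r + 1).
  exists (shift (pt r r) x) => k l kl.
  have [|h v] := leg (k + r%:Z) (l + r%:Z).
    by move: kl; rewrite /rect /box /=; lia.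
  rewrite /code /shift !ptD; split=> kl'.
    rewrite addrAC; apply: h; move: kl kl'; rewrite /rect /box /=; lia.
  rewrite [l + 1 + _]addrAC; apply: v; move: kl kl'; rewrite /rect /box /=; lia.
- move=> k l kl; have [|h v] := leg k l; first by move: kl; rewrite /box /=; lia.
  by split=> kl'; [apply: h | apply: v]; move: kl'; rewrite /box /=; lia.
exists x; apply/legal_setT => k l _.
have [|h v] := Hx (`|k| + `|l| + 1)%N k l; first by rewrite /box /=; lia.
by split=> _; [apply: h | apply: v]; rewrite /box /=; lia.
Qed.

Lemma omega_applies x : wang_shift U x -> applies_to omega x.
Proof.
move=> Xx [k l]; rewrite pt_e1 pt_e2 /concatenable1 /concatenable2 /=.
rewrite /img_height /img_width -!/(code _ _ _); split; apply/eqP.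
  by rewrite (hmatch_short (code_in _ _ _) (code_in _ _ _) (hmatchX Xx k l)).
by rewrite (vmatch_narrow (code_in _ _ _) (code_in _ _ _) (vmatchX Xx k l)).
Qed.

Lemma shiftK (n : int * int) (x : config tile) : shift (- n) (shift n x) = x.
Proof. by apply: funext => m; rewrite /shift addrNK. Qed.

Lemma self_similar_U : self_similar (wang_shift U).
Proof.
split; first exact: subshift_U.
exists omega; split; [exact: omega_expansive | exact: omega_applies |].
apply/seteqP; split=> [y Xy|_ [n [x [z [Xx im ->]]]]].
  have [x [p [q [Xx inf]]]] := desubstitution Xy.
  exists (- pt (p 0) (q 0)), x, (shift (pt (p 0) (q 0)) y); split=> //.
    exact: inflates_is_image inf.
  by rewrite shiftK.
apply: shift_legal; apply: image_legal Xx.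
exact: is_image_inflates im.
Qed.

Lemma aperiodic_U : aperiodic (wang_shift U).
Proof.
split; first exact: wang_shift_nonempty.
case=> x [Xx [[v1 v2] /eqP v0 per]]; apply: v0.
by have [-> ->] := no_period Xx (leqnn _) per.
Qed.

(** * Minimality *)

Definition quad_of (x : config tile) (k l : int) : quad :=
  (code x k l, code x (k + 1) l, code x k (l + 1), code x (k + 1) (l + 1)).

Lemma child_occurs x p q y k l Q : inflates omega_letter setT x p q y ->
  Q \in children (quad_of x k l) -> exists k' l', quad_of y k' l' = Q.
Proof.
move=> /inflatesP H; rewrite /quad_of /children.
set a := code x k l; set b := code x (k + 1) l.
set c := code x k (l + 1); set d := code x (k + 1) (l + 1).
have [p1 q1 Ca] := H k l I; have [p2 q1' Cb] := H (k + 1) l I.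
have [p1' q2 Cc] := H k (l + 1) I; have [p2' q2' Cd] := H (k + 1) (l + 1) I.
rewrite -/a in Ca; rewrite -/b in Cb; rewrite -/c in Cc; rewrite -/d in Cd.
have hb : img_height b = img_height a by rewrite /a /b; lia.
have wc : img_width c = img_width a by rewrite /a /c; lia.
have wdE : img_width d = img_width b by rewrite /b /d; lia.
have hdE : img_height d = img_height c by rewrite /c /d; lia.
have cellE i j : (i < img_width a + img_width b)%N ->
    (j < img_height a + img_height c)%N ->
    code y (p k + i%:Z) (q l + j%:Z) = composite a b c d i j.
  rewrite /composite => ib jc; case: ltnP => iw; case: ltnP => jh.
  - exact: Ca.
  - rewrite -Cc ?wc; try lia.
    by congr (code y _ _); rewrite q1 -/a; lia.
  - rewrite -Cb ?hb; try lia.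
    by congr (code y _ _); rewrite p1 -/a; lia.
  rewrite -Cd ?wdE ?hdE; try lia.
  by congr (code y _ _); rewrite ?p1 ?q1 -/a; lia.
move=> /allpairsP[[i j] /= []]; rewrite !mem_iota !add0n => /= iw jh ->.
have b0 := img_width_gt0 b; have c0 := img_height_gt0 c.
exists (p k + i%:Z), (q l + j%:Z); rewrite !addzS /quad_at !cellE //; lia.
Qed.

(** [x'] is the [n]-th preimage of [x]. *)
Lemma descendants_occur n x : wang_shift U x ->
  exists2 x', wang_shift U x' & forall k l R, descends n (quad_of x' k l) R ->
    exists k' l', quad_of x k' l' = R.
Proof.
move=> Xx; elim: n => [|n [x' Xx' IH]].
  by exists x => // k l R /eqP <-; exists k, l.
have [x1 [p [q [Xx1 inf]]]] := desubstitution Xx'; exists x1 => // k l R.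
by move=> /hasP[Q /(child_occurs inf)[k' [l' <-]] /IH].
Qed.

(** The square at the origin of the 12th preimage of [x] leads to [hub] in 6 steps,
    and [hub] leads to any square in 6 more. *)
Lemma quads_occur x R : wang_shift U x -> R \in quads ->
  exists k l, quad_of x k l = R.
Proof.
move=> Xx Rq; have [x1 Xx1 H1] := descendants_occur 6 Xx.
have [x2 Xx2 H2] := descendants_occur 6 Xx1.
have [|k [l E]] := H2 0 0 hub.
  apply: (allP quads_to_hub); by have [] := window_facts Xx2 0 0.
by apply: (H1 k l); rewrite E; apply: (allP hub_to_quads).
Qed.

(** The [n]-th preimage of [y], with the cuts of the [n]-th iterate of [omega]. *)
Lemma ancestor n y : wang_shift U y -> exists (x : config tile) P Q,
  wang_shift U x /\
  forall k l a b, (0 < a)%N -> (0 < b)%N -> exists a' b',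
    [/\ P (k + a%:Z) = P k + a'%:Z, Q (l + b%:Z) = Q l + b'%:Z,
        (0 < a')%N && (0 < b')%N &
        mor_iter omega n (crop x k l a b) = Some (crop y (P k) (Q l) a' b')].
Proof.
move=> Xy; elim: n => [|n [x [P [Q [Xx H]]]]].
  by exists y, id, id; split=> // k l a b a0 b0; exists a, b; rewrite a0.
have [x1 [p [q [Xx1 inf]]]] := desubstitution Xx.
exists x1, (P \o p), (Q \o q); split=> // k l a b a0 b0.
have inf' : inflates omega_letter (rect k l a b) x1 p q x by apply: inflates_sub inf.
have [a1 [b1 [pa qb om_x]]] := omega_crop inf' a0 b0.
have [pS qS] := inflates_cuts omega_nonempty inf.
have := cuts_growth pS k a; have := cuts_growth qS l b; rewrite pa qb => bb aa.
have [||a' [b' [Pa Qb ab it]]] := H (p k) (q l) a1 b1; try lia.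
exists a', b'; rewrite /= pa qb; split=> //.
exact: mor_iterSr om_x it.
Qed.

(** The blocks of the [n]-th iterate have sides at least [n], so that the window
    of [y] meets at most two of them in each direction: it lies in the image of one
    square of the [n]-th preimage.  That square also occurs in the [n]-th preimage of
    [x], and equal words have equal images. *)
Lemma window_occurs x y n k l : wang_shift U x -> wang_shift U y ->
  exists k' l', forall i j : nat, (i < n)%N -> (j < n)%N ->
    x (pt (k' + i%:Z) (l' + j%:Z)) = y (pt (k + i%:Z) (l + j%:Z)).
Proof.
move=> Xx Xy.
have [z [P [Q [Xz H]]]] := ancestor n Xy.
(* A block of the [n]-th iterate is the [n]-th image of a single tile. *)
have long K L : P K + (maxn 1 n)%:Z <= P (K + 1) /\ Q L + (maxn 1 n)%:Z <= Q (L + 1).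
  have [//|//|a' [b' [-> -> _ it]]] := H K L 1%N 1%N.
  have [z0 [a [b [it0 _ an bn _]]]] := omega_iter_legal (z (pt K L)) n.
  move: it; rewrite crop1 it0 => -[ea eb _]; lia.
have PS K : P K < P (K + 1) by have := (long K 0).1; lia.
have QS L : Q L < Q (L + 1) by have := (long 0 L).2; lia.
have [K kK] := cuts_cover PS k; have [L lL] := cuts_cover QS l.
have [//|//|a [b [Pa Qb _ it]]] := H K L 2%N 2%N.
(* The window starts in block [K] and block [K + 1] is at least [n] wide. *)
have ea : k - P K + n%:Z <= a%:Z.
  by have := (long (K + 1) 0).1; rewrite -addrA -[1 + 1]/(2%:Z) Pa; lia.
have eb : l - Q L + n%:Z <= b%:Z.
  by have := (long 0 (L + 1)).2; rewrite -addrA -[1 + 1]/(2%:Z) Qb; lia.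
have [z' [P' [Q' [Xz' H']]]] := ancestor n Xx.
have [_ _ _ qd] := window_facts Xz K L.
have [K' [L' [e00 e10 e01 e11]]] := quads_occur Xz' qd.
have E : crop z' K' L' 2 2 = crop z K L 2 2.
  apply/crop_ext => -[|[|i]] [|[|j]] // _ _; rewrite ?addr0; exact: num_inj.
have [//|//|a' [b' [_ _ _ it']]] := H' K' L' 2%N 2%N.
move: it'; rewrite E it => /Some_inj C.
have eqa : a = a' := congr1 (@width tile) C.
have eqb : b = b' := congr1 (@height tile) C.
move: C; rewrite -eqa -eqb => /esym /crop_ext C.
exists (P' K' + (k - P K)), (Q' L' + (l - Q L)) => i j ilt jlt.
have [i' Ei] : exists i' : nat, i'%:Z = k - P K + i%:Z.
  by exists `|(k - P K + i%:Z)%R|%N; lia.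
have [j' Ej] : exists j' : nat, j'%:Z = l - Q L + j%:Z.
  by exists `|(l - Q L + j%:Z)%R|%N; lia.
rewrite -[_ + i%:Z]addrA -[_ + j%:Z]addrA -Ei -Ej C; try lia.
by congr (y (pt _ _)); lia.
Qed.

(** A closed invariant subset containing [x] contains every limit of shifts of [x],
    and these are all the tilings by [window_occurs]. *)
Lemma minimal_U : minimal (wang_shift U).
Proof.
split; first exact: subshift_U.
case=> Y [[x Yx] [YX nXY] cY iY]; apply: nXY => y Xy.
apply: (closed_approx cY) => r.
have [k [l E]] := window_occurs (2 * r + 1) (- r%:Z) (- r%:Z) (YX _ Yx) Xy.
exists (shift (pt (k + r%:Z) (l + r%:Z)) x); split; first exact: iY.
move=> [k' l']; rewrite /box /= => /andP[kr lr].
have := E `|(k' + r%:Z)%R|%N `|(l' + r%:Z)%R|%N.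
have -> : - r%:Z + `|(k' + r%:Z)%R|%N%:Z = k' by lia.
have -> : - r%:Z + `|(l' + r%:Z)%R|%N%:Z = l' by lia.
rewrite /shift ptD => <-; try lia.
by congr (x (pt _ _)); lia.
Qed.

Theorem theorem1 :
  self_similar (wang_shift U) /\ aperiodic (wang_shift U) /\
  minimal (wang_shift U).
Proof.
split; first exact: self_similar_U.
by split; [exact: aperiodic_U | exact: minimal_U].
Qed.
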